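(* Let $A$ be an infinite dimensional simple separable unital C*-algebra and let $\alpha \in \mathrm{Aut}(A)$ be strongly tracially approximately inner and satisfy $\alpha^n = \mathrm{id}_A$. Suppose $\alpha$ generates an action of $\mathbb{Z}/n\mathbb{Z}$ with the tracial Rokhlin property. Then this action is tracially approximately representable.
   Context: Throughout, $A$ is an infinite dimensional simple separable unital C*-algebra, and $\overline{xAx}$ is the hereditary subalgebra generated by a positive element $x$. The action generated by $\alpha$ with $\alpha^n = \mathrm{id}_A$ is $k \mapsto \alpha^k$ for $k \in \mathbb{Z}/n\mathbb{Z}$. Strong tracial approximate innerness: $\alpha \in \mathrm{Aut}(A)$ is strongly tracially approximately inner if for every finite set $F \subset A$, every $\varepsilon > 0$, and every positive element $x \in A$ with $\|x\| = 1$, there exist a projection $e \in A$ and a partial isometry $v \in A$ with $v^*v = e$ and $vv^* = \alpha(e)$ such that: (1) $\|\alpha(e) - e\| < \varepsilon$; (2) $\|ea - ae\| < \varepsilon$ for all $a \in F$; (3) $\|v eae v^* - \alpha(eae)\| < \varepsilon$ for all $a \in F$; (4) $1 - e$ is Murray-von Neumann equivalent to a projection in $\overline{xAx}$; (5) $\|e x e\| > 1 - \varepsilon$. Equivalently (and this is the form in which the definition is stated), $v$ may be taken to be a unitary in $eAe$ in place of such a partial isometry, with the same conditions (1)--(5). Tracial Rokhlin property: an action $\gamma \colon G \to \mathrm{Aut}(A)$ of a finite group $G$ has the tracial Rokhlin property if for every finite set $F \subset A$, every $\varepsilon > 0$, and every positive element $x \in A$ with $\|x\| = 1$, there are mutually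 orthogonal projections $e_g \in A$ for $g \in G$ such that: (1) $\|\gamma_g(e_h) - e_{gh}\| < \varepsilon$ for all $g, h \in G$; (2) $\|e_g a - a e_g\| < \varepsilon$ for all $g \in G$ and $a \in F$; (3) with $e = \sum_{g \in G} e_g$, the projection $1 - e$ is Murray-von Neumann equivalent to a projection (possibly zero) in $\overline{xAx}$; (4) $\|e x e\| > 1 - \varepsilon$. Tracial approximate representability: an action $\gamma \colon G \to \mathrm{Aut}(A)$ of a finite abelian group $G$ is tracially approximately representable if for every finite set $F \subset A$, every $\varepsilon > 0$, and every positive element $x \in A$ with $\|x\| = 1$, there are a projection $e \in A$ and unitaries $w_g \in eAe$ for $g \in G$ such that: (1) $\|ea - ae\| < \varepsilon$ for all $a \in F$; (2) $\|\gamma_g(eae) - w_g eae w_g^*\| < \varepsilon$ for all $a \in F$ and $g \in G$; (3) $\|w_g w_h - w_{gh}\| < \varepsilon$ for all $g, h \in G$; (4) $\|\gamma_g(w_h) - w_h\| < \varepsilon$ for all $g, h \in G$; (5) $1 - e$ is Murray-von Neumann equivalent to a projection in $\overline{xAx}$; (6) $\|e x e\| > 1 - \varepsilon$. *)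

(* Defs.v *)
From HB Require Import structures.
From mathcomp Require Import all_boot all_order all_algebra all_fingroup.
From mathcomp Require Import boolp classical_sets functions cardinality reals.
From mathcomp Require Import topology normedtype.
From mathcomp Require Import complex.

Set Implicit Arguments.
Unset Strict Implicit.
Unset Printing Implicit Defensive.

Import Order.TTheory GRing.Theory Num.Theory.
Import numFieldNormedType.Exports.

Local Open Scope classical_set_scope.
Local Open Scope ring_scope.
Local Open Scope complex_scope.

(* Rings and normed modules cannot be joined in one HB structure without a join
   declared below numDomainType, so an algebra A with a norm gets its normed
   module structure, and hence its topology, on the alias normed_space A. *)

HB.mixin Record Algebra_isNormed (R : realType) A of GRing.Algebra R[i] A := {
  cnorm : A -> R ;
  cnormD : forall x y : A, cnorm (x + y) <= cnorm x + cnorm y ;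
  cnormZ : forall (k : R[i]) (x : A), cnorm (k *: x) = Normc.normc k * cnorm x ;
  cnorm0_eq0 : forall x : A, cnorm x = 0 -> x = 0 ;
  cnormM : forall x y : A, cnorm (x * y) <= cnorm x * cnorm y
}.

#[short(type="normedAlgType")]
HB.structure Definition NormedAlgebra (R : realType) :=
  { A of GRing.Algebra R[i] A & Algebra_isNormed R A }.

Definition normed_space (R : realType) (A : normedAlgType R) : Type := A.

Section NormedSpace.
Context {R : realType} {A : normedAlgType R}.
Let V := normed_space A.

HB.instance Definition _ := GRing.Lmodule.on V.

Let norm (x : V) : R[i] := (cnorm (x : A))%:C.

Let ler_normD (x y : V) : norm (x + y) <= norm x + norm y.
Proof. by rewrite /norm -rmorphD /= lecR cnormD. Qed.

Let normrZ (k : R[i]) (x : V) : norm (k *: x) = `|k| * norm x.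
Proof. by rewrite /norm cnormZ rmorphM. Qed.

Let normr0_eq0 (x : V) : norm x = 0 -> x = 0.
Proof. by move=> [] /cnorm0_eq0. Qed.

HB.instance Definition _ :=
  Lmodule_isNormed.Build R[i] V ler_normD normrZ normr0_eq0.

End NormedSpace.

(* Completeness is the library's: every Cauchy filter converges. *)
HB.mixin Record isCStarAlgebra (R : realType) A of NormedAlgebra R A := {
  cstar_complete : forall F : set_system (normed_space A),
    ProperFilter F -> cauchy F -> cvg F ;
  star : A -> A ;
  starD : forall x y : A, star (x + y) = star x + star y ;
  starZ : forall (k : R[i]) (x : A), star (k *: x) = conjc k *: star x ;
  starM : forall x y : A, star (x * y) = star y * star x ;
  starK : involutive star ;
  cstar_identity : forall x : A, cnorm (star x * x) = cnorm x ^+ 2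
}.

(* Unital C*-algebras; they are nonzero, as 1 != 0 in an algType. *)
#[short(type="cstarAlgType")]
HB.structure Definition CStarAlgebra (R : realType) :=
  { A of NormedAlgebra R A & isCStarAlgebra R A }.

HB.instance Definition _ (R : realType) (A : cstarAlgType R) :=
  Uniform_isComplete.Build (normed_space A) (@cstar_complete R A).

Section CStarNotions.
Context {R : realType} {A : cstarAlgType R}.
Implicit Types (x y e p q u v : A) (I : set A).

Definition infinite_dimensional (B : cstarAlgType R) : Prop :=
  ~ exists s : seq B, forall b : B, exists c : 'I_(size s) -> R[i],
      b = \sum_(i < size s) c i *: s`_i.

Definition separable (B : cstarAlgType R) : Prop :=
  exists D : set B, countable D /\ dense (D : set (normed_space B)).

(* Scalar multiples need no separate clause, the algebra being unital. *)
Definition two_sided_ideal I : Prop :=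
  [/\ I 0,
      forall x y, I x -> I y -> I (x + y)
    & forall a x, I x -> I (a * x) /\ I (x * a)].

Definition selfadjoint x : Prop := star x = x.

Definition invertible x : Prop := exists y, x * y = 1 /\ y * x = 1.

Definition spectrum x : set R[i] := [set l | ~ invertible (x - l%:A)].

Definition positive x : Prop :=
  selfadjoint x /\ forall l, spectrum x l -> 0 <= l.

Definition projection p : Prop := selfadjoint p /\ p * p = p.

Definition mvn_equiv p q : Prop := exists v, star v * v = p /\ v * star v = q.

Definition corner e : set A := [set e * a * e | a in [set: A]].

Definition corner_unitary e u : Prop :=
  [/\ corner e u, star u * u = e & u * star u = e].

(* The closure of xAx is the hereditary subalgebra generated by a positive x. *)
Definition hereditary x : set A :=
  closure ([set x * a * x | a in [set: A]] : set (normed_space A)).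

Definition mvn_into_hereditary p x : Prop :=
  exists q, [/\ projection q, hereditary x q & mvn_equiv p q].

End CStarNotions.

Definition simple (R : realType) (A : cstarAlgType R) : Prop :=
  forall I : set A, two_sided_ideal I -> closed (I : set (normed_space A)) ->
    I = [set 0] \/ I = [set: A].

Record starAut (R : realType) (A : cstarAlgType R) := StarAut {
  aut_fun :> {lrmorphism A -> A} ;
  aut_bij : bijective aut_fun ;
  aut_star : forall x : A, aut_fun (star x) = star (aut_fun x)
}.

Section AutPower.
Context {R : realType} {A : cstarAlgType R}.

Definition aut_id : starAut A :=
  @StarAut R A idfun (Bijective (fun=> erefl) (fun=> erefl)) (fun=> erefl).

Lemma aut_comp_star (f g : starAut A) (x : A) :
  (f \o g) (star x) = star ((f \o g) x).
Proof. by rewrite /= !aut_star. Qed.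

Definition aut_comp (f g : starAut A) : starAut A :=
  @StarAut R A (f \o g) (bij_comp (aut_bij f) (aut_bij g))
    (aut_comp_star f g).

Definition aut_pow (f : starAut A) (k : nat) : starAut A :=
  iter k (aut_comp f) aut_id.

Lemma aut_powE f k x : aut_pow f k x = iter k f x.
Proof. by elim: k => //= k ->. Qed.

End AutPower.

Record autAction (gT : finGroupType) (R : realType) (A : cstarAlgType R) :=
  AutAction {
    act_fun :> gT -> starAut A ;
    act_one : forall a, act_fun 1%g a = a ;
    act_mul : forall g h a, act_fun (g * h)%g a = act_fun g (act_fun h a)
  }.

Section CyclicAction.
Context {R : realType} {A : cstarAlgType R} (alpha : starAut A) (n : nat).
Hypothesis alpha_n : forall a, aut_pow alpha n.+1 a = a.

Lemma cyclic_act_one (a : A) : aut_pow alpha (1%g : 'I_n.+1) a = a.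
Proof. by []. Qed.

Lemma cyclic_act_mul (g h : 'I_n.+1) (a : A) :
  aut_pow alpha (g * h)%g a = aut_pow alpha g (aut_pow alpha h a).
Proof.
have powM q b : iter (q * n.+1) alpha b = b.
  by elim: q => // q IH; rewrite mulSn iterD IH -aut_powE alpha_n.
rewrite !aut_powE -iterD [in RHS](divn_eq (g + h) n.+1) addnC iterD powM.
by [].
Qed.

(* Z/(n+1)Z is 'I_n.+1, whose group law is addition modulo n.+1. *)
Definition cyclic_action : autAction 'I_n.+1 A :=
  @AutAction 'I_n.+1 R A (fun k : 'I_n.+1 => aut_pow alpha k)
    cyclic_act_one cyclic_act_mul.

End CyclicAction.

Definition strongly_tracially_approx_inner (R : realType)
    (A : cstarAlgType R) (alpha : starAut A) : Prop :=
  forall (F : set A) (eps : R) (x : A),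
    finite_set F -> 0 < eps -> positive x -> cnorm x = 1 ->
  exists e v : A,
    [/\ projection e, corner_unitary e v &
    [/\ cnorm (alpha e - e) < eps,
        forall a, F a -> cnorm (e * a - a * e) < eps,
        forall a, F a ->
          cnorm (v * (e * a * e) * star v - alpha (e * a * e)) < eps,
        mvn_into_hereditary (1 - e) x
      & 1 - eps < cnorm (e * x * e)]].

Definition tracial_Rokhlin (gT : finGroupType) (R : realType)
    (A : cstarAlgType R) (gamma : autAction gT A) : Prop :=
  forall (F : set A) (eps : R) (x : A),
    finite_set F -> 0 < eps -> positive x -> cnorm x = 1 ->
  exists p : gT -> A,
    [/\ forall g, projection (p g),
        forall g h, g != h -> p g * p h = 0 &
        let e := \sum_g p g in
    [/\ forall g h, cnorm (gamma g (p h) - p (g * h)%g) < eps,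
        forall g a, F a -> cnorm (p g * a - a * p g) < eps,
        mvn_into_hereditary (1 - e) x
      & 1 - eps < cnorm (e * x * e)]].

Definition tracially_approx_representable (gT : finGroupType) (R : realType)
    (A : cstarAlgType R) (gamma : autAction gT A) : Prop :=
  abelian [set: gT]%SET /\
  forall (F : set A) (eps : R) (x : A),
    finite_set F -> 0 < eps -> positive x -> cnorm x = 1 ->
  exists (e : A) (w : gT -> A),
    [/\ projection e, forall g, corner_unitary e (w g) &
    [/\ forall a, F a -> cnorm (e * a - a * e) < eps,
        forall g a, F a ->
          cnorm (gamma g (e * a * e) - w g * (e * a * e) * star (w g)) < eps,
        forall g h, cnorm (w g * w h - w (g * h)%g) < eps
      & [/\ forall g h, cnorm (gamma g (w h) - w h) < eps,
        mvn_into_hereditary (1 - e) x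
      & 1 - eps < cnorm (e * x * e)]]].

(* Main.v *)
From Stdlib Require Import -(notations) Ncring Ncring_tac.
From HB Require Import structures.
Require Import Defs.
From mathcomp Require Import all_boot all_order all_algebra all_fingroup.
From mathcomp Require Import boolp classical_sets functions cardinality reals.
From mathcomp Require Import topology normedtype sequences.
From mathcomp Require Import complex.
From mathcomp Require Import generic_quotient ring_quotient.
From mathcomp Require Import ring lra.

Set Implicit Arguments.
Unset Strict Implicit.
Unset Printing Implicit Defensive.

Import Order.TTheory GRing.Theory Num.Theory.
Import numFieldNormedType.Exports.

Local Open Scope classical_set_scope.
Local Open Scope ring_scope.
Local Open Scope complex_scope.

(** Let N be the order of the action. For N = 1 the pair e = 1, w = 1 works, so
let N be at least 2. In the algebra [asymp] of bounded sequences of A modulo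
sequences tending to 0, conditions that hold up to every tolerance become
equations, and the heart of the proof is algebra there.

The unitary. The tracial Rokhlin property gives orthogonal projections P_0, ...,
P_(N-1) that commute with F and its translates and are permuted cyclically by
alpha. Strong tracial approximate innerness, applied afterwards, gives an alpha-
invariant projection e and a unitary v of its corner that implements alpha on F
and on the P_i. Put
    w0 = v (P_0 + ... + P_(N-2)) + (v^* )^(N-1) P_(N-1).
It climbs through the P_i with v and returns from the last one to the first by
undoing all the climbing, so w0^N is the projection E = e (P_0 + ... + P_(N-1)),
of whose corner w0 is a unitary ([shift_order]). On P_(N-1) it implements
alpha^(1-N), which is alpha because alpha^N = 1 ([shift_implements]). A second
application of the tracial Rokhlin property gives projections q_0, ..., q_(N-1)
that commute with all of this, and the average w = sum_i q_i alpha^i(w0) is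
fixed by alpha while keeping the properties of w0 ([average_fixed],
[average_order], [average_implements]). Its support is e' = q E, with q the sum
of the q_i, and the powers of w are the unitaries wanted. Projections and
unitaries of corners lift from [asymp] to sequences of projections and unitaries
([lift_projection], [lift_corner_unitary]), and a late enough term of these
sequences is the answer ([transfer]).

The size of the support. Three projections have been cut off, and their
complements must fit together inside the hereditary subalgebra of x, while
e' x e' must keep almost all of its norm. If some positive x0 generates a
hereditary subalgebra without nonzero projections, then testing against x0
forces the three complements to be 0. Otherwise every such subalgebra contains
a nonzero projection ([property_SP]). One of them lies under a spectral cut of
x close to its norm ([top_cut]), and since N is at least 2 the Rokhlin
projections let it be split into orthogonal pieces z, c1, c2, c3
([split_projection]). By simplicity there is a nonzero projection z1 under z
that is equivalent to a subprojection of c1 ([comparison]). Testing the first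
family against z1 puts the complement of its projection p under c1, and since
p z1 p is not small, a nonzero projection under z1 almost survives below p
([cut_down]). The other two families are treated in the same way, with this
survivor in place of z and with c2, c3 in place of c1. What survives at the end
is almost dominated by e' and lies under the spectral cut, whence the norm of
e' x e' ([reservoir]).

The analysis underneath uses only completeness and the C*-identity. A sum of two
commuting squares dominates each of them in norm ([comm_sq_le]), and 1 - h has a
square root, obtained by an iteration ([visser_fix], [csqrt]). Together they
replace positivity: automorphisms are contractive ([aut_contract]), almost
idempotent elements are close to projections ([near_projection]), and polar
decomposition is available near a projection ([polar]). *)

(** * Identities in noncommutative rings *)

(** [Ncring] normalizes both sides of an identity without commuting factors; the
    instances feed it the laws of a ring. *)
#[local] Instance nc_ops (A : pzRingType) :
  @Ring_ops A (0:A) (1:A) +%R *%R (fun x y => x - y) -%R eq := {}.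
#[local] Instance nc_ring (A : pzRingType) : @Ring A 0 1 +%R *%R (fun x y => x - y) -%R eq (nc_ops A).
Proof.
split.
exact: RelationClasses.eq_equivalence.
by move=> ? ? -> ? ? ->.
by move=> ? ? -> ? ? ->.
by move=> ? ? -> ? ? ->.
by move=> ? ? ->.
exact: add0r.
exact: addrC.
exact: addrA.
exact: mul1r.
exact: mulr1.
exact: mulrA.
exact: mulrDl.
move=> x y z; exact: mulrDr.
by [].
exact: subrr.
Qed.

Ltac ncring := rewrite ?mulr2n; non_commutative_ring.

(** * Norm, involution and limits *)

Section Basics.
Context {R : realType} {A : cstarAlgType R}.
Implicit Types (x y z h k b : A) (r s : R).

Lemma normcR r : Normc.normc r%:C = `|r|.
Proof. by rewrite /Normc.normc /= expr0n /= addr0 sqrtr_sqr. Qed.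

Lemma cnormZr r x : cnorm (r%:C *: x) = `|r| * cnorm x.
Proof. by rewrite cnormZ normcR. Qed.

Lemma cnorm0 : cnorm (0 : A) = 0.
Proof. by rewrite -(scale0r (0 : A)) cnormZ Normc.normc0 mul0r. Qed.

Lemma cnormN x : cnorm (- x) = cnorm x.
Proof.
by rewrite -scaleN1r -(rmorphN1 (real_complex R)) cnormZr normrN1 mul1r.
Qed.

Lemma cnorm_ge0 x : 0 <= cnorm x.
Proof.
have := cnormD x (- x); rewrite subrr cnorm0 cnormN.
lra.
Qed.

Lemma cnormBC x y : cnorm (x - y) = cnorm (y - x).
Proof. by rewrite -opprB cnormN. Qed.

Lemma cnormB x y : cnorm (x - y) <= cnorm x + cnorm y.
Proof. by rewrite -(cnormN y) cnormD. Qed.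

Lemma cdist_trans y x z : cnorm (x - z) <= cnorm (x - y) + cnorm (y - z).
Proof. by rewrite -[x - z](subrKA y) cnormD. Qed.

Lemma cnorm_le_dist x y : cnorm x <= cnorm y + cnorm (x - y).
Proof. by have := cnormD y (x - y); rewrite addrC subrK. Qed.

Lemma cnorm_eq0 x : cnorm x <= 0 -> x = 0.
Proof. by move=> x0; apply/cnorm0_eq0/le_anti; rewrite x0 cnorm_ge0. Qed.

Lemma cnorm_gt0 x : x <> 0 -> 0 < cnorm x.
Proof.
by move=> x0; rewrite lt_neqAle cnorm_ge0 andbT eq_sym; apply/eqP => /cnorm0_eq0.
Qed.

Lemma cnormMle x y (a b : R) : cnorm x <= a -> cnorm y <= b -> cnorm (x * y) <= a * b.
Proof.
by move=> xa yb; apply: (le_trans (cnormM x y)); rewrite ler_pM // cnorm_ge0.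
Qed.

Lemma star0 : star (0 : A) = 0.
Proof. by rewrite -(scale0r (0 : A)) starZ conjc0 !scale0r. Qed.

Lemma starN x : star (- x) = - star x.
Proof. by apply/eqP; rewrite -subr_eq0 opprK -starD addNr star0. Qed.

Lemma starB x y : star (x - y) = star x - star y.
Proof. by rewrite starD starN. Qed.

Lemma star1 : star (1 : A) = 1.
Proof. by have := starM (star 1) (1 : A); rewrite mulr1 starK mulr1. Qed.

Lemma starZr r x : star (r%:C *: x) = r%:C *: star x.
Proof. by rewrite starZ conjc_real. Qed.

Lemma star_sum I (l : seq I) (P : pred I) (f : I -> A) :
  star (\sum_(i <- l | P i) f i) = \sum_(i <- l | P i) star (f i).
Proof. exact: (big_morph _ starD star0). Qed.

Lemma cnorm1 : cnorm (1 : A) = 1.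
Proof.
have := cstar_identity (1 : A); rewrite star1 mulr1 expr2.
have: 0 < cnorm (1 : A) by apply: cnorm_gt0; apply/eqP; exact: oner_neq0.
by move=> /lt0r_neq0 n0 /esym /(canRL (mulfK n0)); rewrite divff.
Qed.

(** The C*-identity and submultiplicativity give cnorm x ^ 2 <= cnorm (star x) * cnorm x. *)
Lemma cnorm_star x : cnorm (star x) = cnorm x.
Proof.
suff le z : cnorm z <= cnorm (star z).
  by apply/le_anti; rewrite le andbT -{2}(starK x) le.
have [->|z0] := eqVneq z 0; first by rewrite star0.
have zp : 0 < cnorm z by apply/cnorm_gt0/eqP.
have := cnormM (star z) z; rewrite cstar_identity expr2.
by rewrite ler_pM2r.
Qed.

Lemma cnorm_sq x : selfadjoint x -> cnorm (x * x) = cnorm x ^+ 2.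
Proof. by move=> sx; rewrite -{1}sx cstar_identity. Qed.

Lemma halfMn x : (2^-1)%:C *: (x *+ 2) = x.
Proof.
rewrite -scalerMnr scalerMnl -rmorphMn /= -[_ *+ 2]mulr_natl divff ?scale1r //.
by rewrite pnatr_eq0.
Qed.

Lemma cnormMn x n : cnorm (x *+ n) = cnorm x *+ n.
Proof.
rewrite -scaler_nat -(rmorph_nat (real_complex R)) cnormZr.
by rewrite ger0_norm ?ler0n // mulr_natl.
Qed.

(** Closedness phrased with the real norm, which keeps the alias [normed_space] and
    its norm with values in R[i] out of the arguments. *)
Definition limit_closed (S : set A) : Prop :=
  forall a, (forall eps : R, 0 < eps -> exists2 b, S b & cnorm (a - b) < eps) -> S a.

Lemma ball_normed_space (a b : normed_space A) (e : R) :
  ball a e%:C b = (cnorm ((a : A) - (b : A)) < e) :> Prop.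
Proof.
rewrite -ball_normE /ball_ /=.
rewrite -[`|_|]/((cnorm ((a : A) - (b : A)))%:C) ltcR //.
Qed.

Lemma closed_limit_closed (I : set A) :
  limit_closed I -> closed (I : set (normed_space A)).
Proof.
move=> Il a /= aI; apply: Il => e e0.
have e0C : 0 < e%:C by rewrite -[0]/(0%:C) ltcR.
have [b [Ib]] := aI (ball a e%:C) (nbhsx_ballx a _ e0C).
by rewrite ball_normed_space; exists b.
Qed.

Lemma closure_approx (I : set A) (a : A) :
  closure (I : set (normed_space A)) a <->
  (forall e : R, 0 < e -> exists2 b, I b & cnorm (a - b) < e).
Proof.
split=> [aI e e0|H B /= /nbhs_ballP[e e0 eB]].
  have e0C : 0 < e%:C by rewrite -[0]/(0%:C) ltcR.
  have [b [Ib]] := aI (ball (a : normed_space A) e%:C) (nbhsx_ballx (a : normed_space A) _ e0C).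
  by rewrite ball_normed_space; exists b.
have er : e = (complex.Re e)%:C by rewrite RRe_real // gtr0_real.
have [|b Ib ab] := H (complex.Re e); first by rewrite -ltcR -er.
by exists b; split=> //; apply: eB; rewrite er ball_normed_space.
Qed.

Lemma cauchy_seq_cvg (u : nat -> A) :
  (forall e : R, 0 < e -> exists K, forall i j, (K <= i)%N -> (K <= j)%N ->
     cnorm (u i - u j) < e) ->
  exists l, forall e : R, 0 < e -> exists K, forall i, (K <= i)%N ->
     cnorm (u i - l) < e.
Proof.
move=> uC; pose v : nat -> normed_space A := u.
have: cvg (v @ \oo).
  apply: cstar_complete; apply/cauchy_exP => e e0.
  have er : e = (complex.Re e)%:C by rewrite RRe_real // gtr0_real.
  have [|K HK] := uC (complex.Re e); first by rewrite -ltcR -er.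
  exists (u K); exists K => //= j /= Kj.
  by rewrite er ball_normed_space; exact: HK.
move=> /cvg_ex[l vl]; exists l => e e0.
have e0C : 0 < e%:C by rewrite -[0]/(0%:C) ltcR.
have [K _ HK] := vl _ (nbhsx_ballx l _ e0C).
exists K => i /= Ki; rewrite cnormBC; have := HK i Ki.
by rewrite /= ball_normed_space.
Qed.

End Basics.

(** * Square roots and inverses by iteration *)

Section SquareRoot.
Context {R : realType} {A : cstarAlgType R}.
Implicit Types (x y z h g p b : A) (r s e : R).

Lemma le_all_eps r C : (forall e, 0 < e -> r <= C * e) -> r <= 0.
Proof.
move=> H; rewrite leNgt; apply/negP => r0.
have C0 : 0 < `|C| + 1 by rewrite ltr_wpDl.
have q0 : 0 < r / (`|C| + 1) / 2 by rewrite !divr_gt0.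
have := H _ q0; apply/negP; rewrite -ltNge.
apply: (@le_lt_trans _ _ ((`|C| + 1) * (r / (`|C| + 1) / 2))).
  by rewrite ler_pM2r // (le_trans (ler_norm _)) // lerDl.
by rewrite mulrA [X in X / 2]mulrCA divff ?lt0r_neq0 //; lra.
Qed.

(** Lipschitz maps agree on a closed set. This is how algebraic identities pass
    from iterates to their limit. *)
Lemma limit_closed_eq (f g : A -> A) C :
  (forall a b, cnorm (f a - f b) <= C * cnorm (a - b)) ->
  (forall a b, cnorm (g a - g b) <= C * cnorm (a - b)) ->
  limit_closed [set a | f a = g a].
Proof.
move=> fC gC a aS; apply/eqP; rewrite -subr_eq0; apply/eqP/cnorm_eq0.
have le_C e b : cnorm (a - b) < e -> C * cnorm (a - b) <= `|C| * e.
  by have := cnorm_ge0 (a - b); have := ler_norm C; have := normr_ge0 C => ? ? ? ?; nra.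
apply: (@le_all_eps _ (`|C| *+ 2)) => e /aS[b /= fgb ab].
rewrite -(subrKA (f b)) (le_trans (cnormD _ _)) // mulrnAl mulr2n lerD //.
  exact: le_trans (fC _ _) (le_C _ _ ab).
by rewrite fgb cnormBC; exact: le_trans (gC _ _) (le_C _ _ ab).
Qed.

(** Stated for the partial sums u and t of two series rather than for their terms,
    because the iterations below produce partial sums. *)
Lemma majorized_cvg (u : nat -> A) (t : nat -> R) M :
  (forall k, cnorm (u k.+1 - u k) <= t k.+1 - t k) -> (forall k, t k <= M) ->
  exists l, forall e, 0 < e -> exists K, forall i, (K <= i)%N ->
     cnorm (u i - l) < e.
Proof.
move=> ut tM; apply: cauchy_seq_cvg => e e0.
have le_ut i d : cnorm (u (i + d)%N - u i) <= t (i + d)%N - t i.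
  elim: d => [|d IH]; first by rewrite addn0 !subrr cnorm0.
  rewrite addnS (le_trans (cdist_trans (u (i + d)%N) _ _)) //.
  by have := ut (i + d)%N; lra.
have t_nd : nondecreasing_seq t.
  apply/nondecreasing_seqP => k; rewrite -subr_ge0.
  by rewrite (le_trans _ (ut k)) ?cnorm_ge0.
have /cvgrPdist_lt tL : cvgn t.
  by apply: nondecreasing_is_cvgn => //; exists M => _ [k _ <-].
have [|K _ HK] := tL (e / 2); first by rewrite divr_gt0.
exists K => i j Ki Kj.
wlog ij : i j Ki Kj / (i <= j)%N.
  by move=> W; case: (leqP i j) => [|/ltnW] ij; [|rewrite cnormBC]; exact: W.
rewrite cnormBC -(subnKC ij) (le_lt_trans (le_ut _ _)) // subnKC //.
have := HK i Ki; have := HK j Kj => /=.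
by rewrite !ltr_norml => /andP[? ?] /andP[? ?]; lra.
Qed.

(** The iteration for a solution z of 2 z = h + z^2, that is (1 - z)^2 = 1 - h. Its
    iterates are polynomials in h with nonnegative coefficients, so they are
    majorized by the scalar iteration started from the norm of h, which stays
    bounded as long as that norm is at most 1. *)
Definition visser h (k : nat) : A :=
  iter k (fun z => (2^-1)%:C *: (h + z * z)) 0.

Let svisser r (k : nat) : R := iter k (fun t => (r + t * t) / 2) 0.

Let svisser_bound r k : 0 <= r <= 1 -> 0 <= svisser r k <= r.
Proof.
move=> /andP[r0 r1]; elim: k => [|k /andP[t0 tr]] /=; first by rewrite lexx.
by rewrite -/(svisser r k); nra.
Qed.

Lemma norm_half x : cnorm ((2^-1)%:C *: x) = cnorm x / 2.
Proof. by rewrite cnormZr ger0_norm ?invr_ge0 // mulrC. Qed.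

Lemma dbl_half x : ((2^-1)%:C *: x) *+ 2 = x.
Proof. by rewrite scalerMnr halfMn. Qed.

Lemma cnorm_dist_sq x y r s : cnorm x <= r -> cnorm y <= r -> cnorm (x - y) <= s ->
  cnorm (x * x - y * y) <= s * (r * 2).
Proof.
move=> xr yr xys.
have -> : x * x - y * y = (x - y) * x + y * (x - y) by rewrite mulrBl mulrBr subrKA.
apply: (le_trans (cnormD _ _)).
have := cnormMle xys xr; have := cnormMle yr xys; lra.
Qed.

(** The last clause is an induction principle for the limit: whatever is closed
    and preserved by a step of the iteration holds for z. Commutation,
    selfadjointness and annihilation all pass to z in this way. *)
Lemma visser_fix h : cnorm h <= 1 -> exists z,
  [/\ z *+ 2 = h + z * z, cnorm z <= cnorm h &
      forall S : set A, S 0 -> (forall a, S a -> S ((2^-1)%:C *: (h + a * a))) ->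
        limit_closed S -> S z].
Proof.
move=> h1; pose z := visser h; pose r := cnorm h; pose t := svisser r.
have r01 : 0 <= r <= 1 by rewrite cnorm_ge0.
have tb k : 0 <= t k <= r by exact: svisser_bound.
have zt k : cnorm (z k) <= t k.
  elim: k => [|k IH] /=; first by rewrite cnorm0.
  rewrite norm_half ler_pM2r ?invr_gt0 // (le_trans (cnormD _ _)) // lerD //.
  exact: cnormMle.
have zz k : cnorm (z k.+1 - z k) <= t k.+1 - t k.
  elim: k => [|k IH].
    by rewrite /= !mul0r !addr0 !subr0 norm_half.
  have -> : z k.+2 - z k.+1 = (2^-1)%:C *: (z k.+1 * z k.+1 - z k * z k).
    by rewrite -scalerBr; congr (_ *: _); rewrite opprD addrACA subrr add0r.
  have -> : t k.+2 - t k.+1 = (t k.+1 * t k.+1 - t k * t k) / 2.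
    by rewrite [t k.+2]/= {2}[t k.+1]/= -mulrBl opprD addrACA subrr add0r.
  rewrite norm_half.
  have -> : z k.+1 * z k.+1 - z k * z k = (z k.+1 - z k) * z k.+1 + z k * (z k.+1 - z k).
    by rewrite mulrBl mulrBr subrKA.
  have := cnormD ((z k.+1 - z k) * z k.+1) (z k * (z k.+1 - z k)).
  have := cnormMle IH (zt k.+1); have := cnormMle (zt k) IH.
  by move=> ? ? ?; lra.
have [|l zl] := @majorized_cvg z t r zz; first by move=> k; case/andP: (tb k).
have lr : cnorm l <= r.
  rewrite -subr_le0; apply: (@le_all_eps _ 1) => e /zl[K /(_ K (leqnn _))].
  have := cnorm_le_dist l (z K); rewrite cnormBC; have /andP[_] := tb K.
  by have := zt K; lra.
exists l; split=> //.
  apply/eqP; rewrite -subr_eq0; apply/eqP/cnorm_eq0.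
  apply: (@le_all_eps _ 4) => e e0; have [K HK] := zl e e0.
  have zS : z K.+1 *+ 2 = h + z K * z K by rewrite dbl_half.
  have -> : l *+ 2 - (h + l * l) = (l - z K.+1) *+ 2 + (z K * z K - l * l).
    by rewrite mulrnBl zS; ncring.
  have := cnormD ((l - z K.+1) *+ 2) (z K * z K - l * l).
  rewrite cnormMn cnormBC mulr2n.
  have /andP[_ tr] := tb K.
  have := cnorm_dist_sq (le_trans (zt K) tr) lr (ltW (HK K (leqnn _))).
  have := HK K.+1 (leqnSn _); case/andP: r01 => ? ?.
  by move=> ? ? ?; nra.
move=> S S0 Sh Sl; apply: Sl => e e0; have [K HK] := zl e e0.
exists (z K); last by rewrite cnormBC; exact: HK.
by elim: (K) => //= k IH; exact: Sh.
Qed.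

(** Square root of 1 - h, including the boundary case of norm 1. The last clause
    says that g is 1 outside the support of h, which is what makes the square
    root usable in corners. *)
Lemma csqrt h : selfadjoint h -> cnorm h <= 1 -> exists g,
  [/\ selfadjoint g, g * g = 1 - h, cnorm (1 - g) <= cnorm h,
      forall b, b * h = h * b -> b * g = g * b
    & forall b, b * h = 0 -> b * g = b].
Proof.
move=> sh /visser_fix[z [z2 zh zS]]; exists (1 - z).
split.
- rewrite /selfadjoint starB star1; congr (_ - _).
  apply: (zS [set a | star a = a]) => /=; first exact: star0.
    by move=> a sa; rewrite starZr starD starM sh sa.
  by apply: (@limit_closed_eq _ _ 1) => a b; rewrite -?starB ?cnorm_star mul1r.
- by rewrite -[h](addrK (z * z)) -z2; ncring.
- by rewrite opprB addrC subrK.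
- move=> b bh; rewrite mulrBl mulrBr mul1r mulr1; congr (_ - _).
  apply: (zS [set a | b * a = a * b]) => /=; first by rewrite mulr0 mul0r.
    move=> a ba; rewrite -scalerAr -scalerAl mulrDr mulrDl bh; congr (_ *: (_ + _)).
    by rewrite mulrA ba -mulrA ba mulrA.
  apply: (@limit_closed_eq _ _ (cnorm b)) => c d.
    by rewrite -mulrBr cnormM.
  by rewrite -mulrBl mulrC cnormM.
- move=> b bh; rewrite mulrBr mulr1; suff -> : b * z = 0 by rewrite subr0.
  apply: (zS [set a | b * a = 0]) => /=; first by rewrite mulr0.
    by move=> a ba; rewrite -scalerAr mulrDr bh mulrA ba mul0r addr0 scaler0.
  apply: (@limit_closed_eq _ _ (cnorm b)) => c d.
    by rewrite -mulrBr cnormM.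
  by rewrite subrr cnorm0 mulr_ge0 ?cnorm_ge0.
Qed.

(** Partial sums of the geometric series. *)
Lemma neumann h : cnorm h < 1 -> invertible (1 - h).
Proof.
move=> h1; pose r := cnorm h.
pose u k := \sum_(i < k) h ^+ i; pose t k := \sum_(i < k) r ^+ i.
have r0 : 0 <= r by exact: cnorm_ge0.
have hr k : cnorm (h ^+ k) <= r ^+ k.
  elim: k => [|k IH]; first by rewrite !expr0 cnorm1.
  by rewrite !exprS cnormMle.
have tk k : (1 - r) * t k = 1 - r ^+ k.
  by rewrite -[LHS]opprK -mulNr opprB -subrX1 opprB.
have uk k : (1 - h) * u k = 1 - h ^+ k.
  by rewrite -[LHS]opprK -mulNr opprB -subrX1 opprB.
have ku k : u k * (1 - h) = 1 - h ^+ k.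
  rewrite -uk mulrBl mulrBr mul1r mulr1; congr (_ - _).
  rewrite mulr_suml mulr_sumr; apply: eq_bigr => i _.
  by rewrite -exprSr -exprS.
have [||l ul] := @majorized_cvg u t ((1 - r)^-1).
- by move=> k; rewrite /u /t !big_ord_recr /= ![_ + _ ^+ _]addrC !addrK.
- move=> k; rewrite -(ler_pM2l (_ : 0 < 1 - r)) ?subr_gt0 // tk divff; last first.
    by rewrite subr_eq0 eq_sym lt_eqF.
  by rewrite gerBl exprn_ge0.
have hK e : 0 < e -> exists2 K, cnorm (u K - l) < e & cnorm (h ^+ K) <= e.
  move=> e0; have [K HK] := ul e e0.
  have [|K' _ HK'] := (cvgrPdist_lt _ _).1 (@cvg_geometric R 1 r _) e e0.
    by rewrite ger0_norm.
  exists (maxn K K'); first by apply: HK; rewrite leq_maxl.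
  apply: (le_trans (hr _)).
  have := HK' (maxn K K') (leq_maxr _ _); rewrite /= sub0r normrN mul1r.
  by rewrite ger0_norm ?exprn_ge0 // => /ltW.
exists l; split; apply/eqP; rewrite eq_sym -subr_eq0; apply/eqP/cnorm_eq0;
  apply: (@le_all_eps _ 3) => e e0; have [K uKl hKe] := hK e e0.
- have -> : 1 - (1 - h) * l = (1 - h) * (u K - l) + h ^+ K.
    by rewrite mulrBr uk; ncring.
  apply: (le_trans (cnormD _ _)).
  have := cnormMle (cnormB 1 h) (ltW uKl); rewrite cnorm1 -/r.
  by move: h1; rewrite -/r => ? ?; have := mulr_ge0 r0 (ltW e0); nra.
- have -> : 1 - l * (1 - h) = (u K - l) * (1 - h) + h ^+ K.
    by rewrite mulrBl ku; ncring.
  apply: (le_trans (cnormD _ _)).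
  have := cnormMle (ltW uKl) (cnormB 1 h); rewrite cnorm1 -/r.
  by move: h1; rewrite -/r => ? ?; have := mulr_ge0 r0 (ltW e0); nra.
Qed.

Lemma inverse_comm x y b : x * y = 1 -> y * x = 1 -> b * x = x * b -> b * y = y * b.
Proof.
by move=> xy yx bx; rewrite -[b * y]mul1r -yx -mulrA (mulrA x) -bx -mulrA xy mulr1.
Qed.

Lemma inverse_sa x y : x * y = 1 -> y * x = 1 -> selfadjoint x -> selfadjoint y.
Proof.
move=> xy yx sx; have : star y * x = 1 by rewrite -{1}sx -starM xy star1.
by move=> E; rewrite /selfadjoint -[LHS]mulr1 -xy mulrA E mul1r.
Qed.

End SquareRoot.

(** * Commuting squares, positivity and spectrum *)

Section Positivity.
Context {R : realType} {A : cstarAlgType R}.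
Implicit Types (x y z h k g p q b : A) (r s e : R) (l m : R[i]).

Lemma scalar_mull l x : l%:A * x = l *: x.
Proof. by rewrite -scalerAl mul1r. Qed.

Lemma scalar_mulr l x : x * l%:A = l *: x.
Proof. by rewrite -scalerAr mulr1. Qed.

(** h is the real part of x = h + i k, and star x * x = h^2 + k^2 because h and k
    commute. This replaces monotonicity of the norm on positive elements. *)
Lemma comm_sq_le h k : selfadjoint h -> selfadjoint k -> h * k = k * h ->
  cnorm h ^+ 2 <= cnorm (h * h + k * k).
Proof.
move=> sh sk hk; pose x := h + 'i *: k.
have sx : star x = h - 'i *: k.
  rewrite starD starZ sh sk.
  have -> : conjc 'i = - 'i :> R[i] by apply/eqP; rewrite eq_complex /= oppr0 !eqxx.
  by rewrite scaleNr.
have -> : h * h + k * k = star x * x.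
  rewrite sx mulrDr !mulrBl -!scalerAl -!scalerAr !scalerA hk.
  have -> : 'i * 'i = -1 :> R[i] by rewrite -expr2 sqr_i.
  by rewrite scaleN1r; ncring.
have -> : h = (2^-1)%:C *: (x + star x).
  have -> : x + star x = h *+ 2 by rewrite sx /x; ncring.
  by rewrite halfMn.
rewrite cstar_identity norm_half ler_pXn2r ?nnegrE ?divr_ge0 ?cnorm_ge0 //.
have := cnormD x (star x); rewrite cnorm_star; lra.
Qed.

(** With g^2 = 1 - h^2, the two commuting squares g^2 and h^2 add up to 1. *)
Lemma norm_1Bsq h : selfadjoint h -> cnorm h <= 1 -> cnorm (1 - h * h) <= 1.
Proof.
move=> sh h1; have [||g [sg g2 _ gC _]] := @csqrt _ _ (h * h).
- by rewrite /selfadjoint starM sh.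
- by rewrite cnorm_sq // expr_le1 // cnorm_ge0.
have hg : g * h = h * g by apply/esym/gC; rewrite mulrA.
have := comm_sq_le sg sh hg; rewrite g2 subrK cnorm1 => ?.
by rewrite -g2 cnorm_sq.
Qed.

(** For selfadjoint y in the unit ball, 1 = y^2 + g^2 is a sum of commuting squares
    and the automorphism preserves this identity. The C*-identity reduces the
    general case to this one. *)
Lemma aut_contract (a : starAut A) x : cnorm (a x) <= cnorm x.
Proof.
have contr1 y : selfadjoint y -> cnorm y <= 1 -> cnorm (a y) <= 1.
  move=> sy y1; have [||g [sg g2 _ gC _]] := @csqrt _ _ (y * y).
  - by rewrite /selfadjoint starM sy.
  - by rewrite cnorm_sq // expr_le1 // cnorm_ge0.
  have yg : y * g = g * y by apply: gC; rewrite mulrA.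
  have := @comm_sq_le (a y) (a g); rewrite /selfadjoint -!aut_star sy sg -!rmorphM yg.
  rewrite g2 -rmorphD addrC subrK rmorph1 cnorm1 => /(_ erefl erefl erefl).
  by rewrite expr_le1 // cnorm_ge0.
have [->|/eqP/cnorm_gt0 x0] := eqVneq x 0; first by rewrite rmorph0.
have := contr1 ((cnorm x ^- 2)%:C *: (star x * x)).
rewrite /selfadjoint starZr starM starK => /(_ erefl).
have n0 : 0 <= cnorm x ^- 2 by rewrite invr_ge0 sqr_ge0.
rewrite linearZ /= !cnormZr ger0_norm // [a (_ * _)]rmorphM /= aut_star !cstar_identity.
rewrite mulVf ?expf_neq0 ?lt0r_neq0 // => /(_ (lexx _)).
by rewrite ler_pdivrMl ?exprn_gt0 // mulr1 ler_pXn2r // nnegrE cnorm_ge0.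
Qed.

Lemma invertibleM x y : invertible x -> invertible y -> invertible (x * y).
Proof.
move=> [x' [xx' x'x]] [y' [yy' y'y]]; exists (y' * x').
by rewrite mulrA -(mulrA x) yy' mulr1 -mulrA (mulrA x') x'x mul1r.
Qed.

Lemma invertibleZ l x : l != 0 -> invertible x -> invertible (l *: x).
Proof.
move=> l0 [x' [xx' x'x]]; exists (l^-1 *: x').
by rewrite -!scalerAl -!scalerAr !scalerA xx' x'x mulfV // mulVf // !scale1r.
Qed.

Lemma normc_sq (a b : R) : Normc.normc (a +i* b) ^+ 2 = a ^+ 2 + b ^+ 2.
Proof. by rewrite /Normc.normc sqr_sqrtr // addr_ge0 // sqr_ge0. Qed.

(** Arens' argument: adding i t to x raises the norm of x less than it raises the
    modulus of l once t is large with the sign of the imaginary part of l, and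
    then the Neumann series applies. *)
Lemma sa_spectrum_real x l : selfadjoint x -> complex.Im l != 0 -> invertible (x - l%:A).
Proof.
move=> sx; case: l => a b /= b0.
pose t := (cnorm x ^+ 2 + 1) / (2 * b).
pose m : R[i] := a +i* (b + t); pose y := x + (0 +i* t)%:A.
have yn : cnorm y ^+ 2 <= cnorm x ^+ 2 + t ^+ 2.
  rewrite -cstar_identity starD starZ star1 sx.
  have -> : (x + ((0 +i* t)^*)%C%:A) * y = x * x + (t ^+ 2)%:C%:A.
    rewrite mulrDr !mulrDl !scalar_mull !scalar_mulr scalerA.
    have -> : conjc (0 +i* t) = - (0 +i* t) by apply/eqP; rewrite eq_complex /= oppr0 !eqxx.
    have -> : - (0 +i* t) * (0 +i* t) = (t ^+ 2)%:C.
      by apply/eqP; rewrite eq_complex /= !(oppr0, mul0r, mulr0, sub0r, addr0, mulNr, opprK) expr2 !eqxx.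
    by rewrite scaleNr; ncring.
  by rewrite (le_trans (cnormD _ _)) // cnorm_sq // cnormZr cnorm1 mulr1 ger0_norm ?sqr_ge0.
have bt : b * t *+ 2 = cnorm x ^+ 2 + 1 by rewrite /t; field.
have m2 : cnorm x ^+ 2 + t ^+ 2 < Normc.normc m ^+ 2.
  by rewrite normc_sq sqrrD bt; have := sqr_ge0 a; have := sqr_ge0 b; lra.
have nm : 0 < Normc.normc m.
  by rewrite lt_neqAle sqrtr_ge0 andbT; apply/eqP => E; move: m2 yn; rewrite -E;
     have := sqr_ge0 (cnorm y); lra.
have m0 : m != 0 by apply: contraTneq nm => ->; rewrite Normc.normc0 ltxx.
have -> : x - (a +i* b)%:A = (- m) *: (1 - m^-1 *: y).
  rewrite scalerBr scalerA mulNr mulfV // scaleN1r opprK [RHS]addrC /y -addrA -scalerDl.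
  rewrite -scaleNr; congr (_ + _%:A); apply/eqP; rewrite eq_complex /=; apply/andP; split; apply/eqP; ring.
apply: invertibleZ; first by rewrite oppr_eq0.
apply: neumann; rewrite cnormZ Normc.normcV.
rewrite mulrC ltr_pdivrMr // mul1r.
rewrite -(@ltr_pXn2r _ 2) ?nnegrE ?cnorm_ge0 ?ltW //.
exact: le_lt_trans yn m2.
Qed.

(** y^2 - s^2 = (y - s) (y + s), and both factors are invertible unless s is real. *)
Lemma sq_positive y : selfadjoint y -> positive (y * y).
Proof.
move=> sy; split; first by rewrite /selfadjoint starM sy.
move=> l nl; have [s s2] : exists s : R[i], s ^+ 2 = l by exists (sqrtc l); rewrite sqr_sqrtc.
have [s0|s0] := eqVneq (complex.Im s) 0.
  rewrite -s2; have -> : s = (complex.Re s)%:C.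
    by case: (s) s0 => a b /= ->.
  by rewrite -rmorphXn -[0]/(0%:C) lecR sqr_ge0.
exfalso; apply: nl.
have -> : y * y - l%:A = (y - s%:A) * (y - (- s)%:A).
  by rewrite scaleNr opprK mulrDr !mulrBl !scalar_mull !scalar_mulr scalerA -s2 expr2; ncring.
apply: invertibleM; apply: sa_spectrum_real => //.
by case: (s) s0 => a b /=; rewrite oppr_eq0.
Qed.

Lemma proj_positive p : projection p -> positive p.
Proof. by case=> sp pp; rewrite -pp; exact: sq_positive. Qed.

Lemma proj_norm1 p : projection p -> p <> 0 -> cnorm p = 1.
Proof.
move=> [sp pp] /cnorm_gt0 p0; have := cstar_identity p; rewrite sp pp expr2.
by move=> /esym/(canRL (mulfK (lt0r_neq0 p0))); rewrite divff ?lt0r_neq0.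
Qed.

Lemma proj_norm_le1 p : projection p -> cnorm p <= 1.
Proof.
move=> pp; have [->|/eqP p0] := eqVneq p 0; first by rewrite cnorm0.
by rewrite (proj_norm1 pp).
Qed.

Lemma proj_small p : projection p -> cnorm p < 1 -> p = 0.
Proof.
move=> pp; have [->//|/eqP p0] := eqVneq p 0.
by rewrite (proj_norm1 pp) // ltxx.
Qed.

Lemma projC p : projection p -> projection (1 - p).
Proof.
move=> [sp pp]; split; first by rewrite /selfadjoint starB star1 sp.
by rewrite mulrBl mul1r mulrBr mulr1 pp subrr subr0.
Qed.

End Positivity.

(** * Projections and hereditary subalgebras *)

Section Projections.
Context {R : realType} {A : cstarAlgType R}.
Implicit Types (x y z h k g p q b : A) (r s e : R) (l m : R[i]).

(** The sign of y = 2 a - 1 is y (y^2)^(-1/2), a selfadjoint square root of 1, and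
    q = (1 + sign) / 2. The last clause says that q stays in any corner that
    contains a. *)
Lemma near_projection a : selfadjoint a -> 4 * cnorm (a * a - a) < 1 ->
  exists q, [/\ projection q, cnorm (q - a) <= 2 * cnorm (a * a - a)
             & forall b, b * a = 0 -> b * q = 0].
Proof.
move=> sa a1; pose y := a *+ 2 - 1; pose h : A := 1 - y * y.
have sy : selfadjoint y by rewrite /selfadjoint /y starB star1 mulr2n starD sa.
have hE : h = - ((a * a - a) *+ 4).
  rewrite /h /y (mulrnA _ 2 2) !mulr2n; ncring.
have hn : cnorm h = 4 * cnorm (a * a - a) by rewrite hE cnormN cnormMn mulr_natl.
have [||g [sg g2 gn gC g1]] := @csqrt _ _ h.
- by rewrite /selfadjoint starB star1 starM sy.
- by rewrite hn ltW.
have := @neumann _ _ (1 - g); rewrite subKr => -[|d [gd dg]].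
  by rewrite (le_lt_trans gn) // hn.
have sd := inverse_sa gd dg sg.
have yg : y * g = g * y by apply: gC; rewrite /h; ncring.
have yd := inverse_comm gd dg yg.
pose u := y * d.
have su : selfadjoint u by rewrite /selfadjoint /u starM sd sy -yd.
have uu : u * u = 1.
  have y2 : y * y = g * g by rewrite g2 /h subKr.
  by rewrite /u {1}yd mulrA -(mulrA d) y2 mulrA dg mul1r.
have un : cnorm u = 1.
  have := cnorm_sq su; rewrite uu cnorm1 => /esym/eqP.
  by rewrite sqrf_eq1 => /orP[/eqP//|/eqP E]; have := cnorm_ge0 u; rewrite E; lra.
have q2 : ((2^-1)%:C *: (1 + u)) *+ 2 = 1 + u by exact: dbl_half.
have qa : (2^-1)%:C *: (1 + u) - a = (2^-1)%:C *: (u - y).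
  rewrite -[LHS]halfMn mulrnBl q2; congr (_ *: _); rewrite /y; ncring.
exists ((2^-1)%:C *: (1 + u)); split.
- split; first by rewrite /selfadjoint starZr starD star1 su.
  rewrite -scalerAl -scalerAr; congr (_ *: _); rewrite -[RHS]halfMn; congr (_ *: _).
  by rewrite -[in LHS]uu; rewrite mulrDr !mulrDl uu; ncring.
- rewrite qa norm_half.
  have -> : u - y = u * (1 - g) by rewrite mulrBr mulr1 /u -mulrA dg mulr1.
  by have := cnormMle (lexx (cnorm u)) gn; rewrite un mul1r hn; lra.
- move=> b ba; have bg : b * g = b.
    by apply: g1; rewrite hE mulrN mulrnAr mulrBr mulrA ba mul0r subrr mul0rn oppr0.
  have bd : b * d = b by rewrite -{1}bg -mulrA gd mulr1.
  rewrite -scalerAr mulrDr mulr1 /u mulrA /y mulrBr mulrnAr ba mul0rn mulr1 sub0r.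
  by rewrite mulNr bd subrr scaler0.
Qed.

(** d is the inverse of the modulus of x p in the corner of p, so that x d is the
    partial isometry of the polar decomposition of x p. *)
Lemma polar p x : projection p -> cnorm (p - p * (star x * x) * p) < 1 ->
  exists d, [/\ selfadjoint d, p * d = d, d * p = d, d * (star x * x) * d = p
    & cnorm (d - p) * (1 - cnorm (p - p * (star x * x) * p)) <= cnorm (p - p * (star x * x) * p)].
Proof.
move=> pj; case: (pj) => [sp pp]; set h := p - _ => h1.
have sh : selfadjoint h by rewrite /selfadjoint /h starB !starM starK sp !mulrA.
have ph : p * h = h by rewrite /h mulrBr !mulrA pp.
have hp : h * p = h by rewrite /h mulrBl -!mulrA pp.
have [g [sg g2 gn gC _]] := csqrt sh (ltW h1).
have := @neumann _ _ (1 - g); rewrite subKr => -[|d [gd dg]].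
  exact: le_lt_trans gn h1.
have sd := inverse_sa gd dg sg.
have pg : p * g = g * p by apply: gC; rewrite ph hp.
have pd := inverse_comm gd dg pg.
have pdp : p * d * p = p * d by rewrite -mulrA -pd mulrA pp.
exists (p * d); split=> //.
- by rewrite /selfadjoint starM sd sp.
- by rewrite mulrA pp.
- have -> : p * d * (star x * x) * (p * d) = d * (p - h) * d.
    by rewrite /h subKr {1}pd !mulrA.
  have -> : p - h = p * (1 - h) by rewrite mulrBr mulr1 ph.
  by rewrite -g2 !mulrA -pd -2!mulrA gd mulr1 -mulrA dg mulr1.
- have E : p * d - p = p * d * (1 - g) by rewrite mulrBr mulr1 -[_ * d * g]mulrA dg mulr1.
  have := cnormMle (lexx (cnorm (p * d))) gn; rewrite -E.
  have := cnorm_le_dist (p * d) p; have := proj_norm_le1 pj.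
  have := cnorm_ge0 h; have := cnorm_ge0 (p * d - p) => ? ? ? ? ?; nra.
Qed.

Lemma hereditaryM x a b c : hereditary x a -> hereditary x c -> hereditary x (a * b * c).
Proof.
move=> /closure_approx xa /closure_approx xc; apply/closure_approx => e e0.
pose C := cnorm a + cnorm b + cnorm c + 1.
have := cnorm_ge0 a; have := cnorm_ge0 b; have := cnorm_ge0 c => c0 b0 a0.
have C0 : 1 <= C by rewrite /C; lra.
pose d := e / (C ^+ 2 * 2 + 1).
have D0 : 0 < C ^+ 2 * 2 + 1 by have := sqr_ge0 C; lra.
have d0 : 0 < d by rewrite divr_gt0.
pose d' := Num.min d 1.
have d'0 : 0 < d' by rewrite lt_min d0 ltr01.
have [_ [a' _ <-] aa] := xa d' d'0; have [_ [c' _ <-] cc] := xc d' d'0.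
exists (x * a' * x * b * (x * c' * x)).
  by exists (a' * x * b * x * c') => //; rewrite !mulrA.
have -> : a * b * c - x * a' * x * b * (x * c' * x) =
   (a - x * a' * x) * b * c + (x * a' * x) * b * (c - x * c' * x).
  by rewrite mulrBr !mulrBl; ncring.
move: aa cc; set u := x * a' * x; set v := x * c' * x => aa cc.
have d'd : d' <= d by rewrite ge_min lexx.
have d'1 : d' <= 1 by rewrite ge_min lexx orbT.
have uC : cnorm u <= C by have := cnorm_le_dist u a; rewrite cnormBC /C; lra.
have bC : cnorm b <= C by rewrite /C; lra.
have cC : cnorm c <= C by rewrite /C; lra.
have ad : cnorm (a - u) <= d by lra.
have cd : cnorm (c - v) <= d by lra.
apply: (le_lt_trans (cnormD _ _)).
have := cnormMle (cnormMle ad bC) cC; have := cnormMle (cnormMle uC bC) cd => ? ?.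
have : d * (C ^+ 2 * 2 + 1) = e by rewrite divfK ?lt0r_neq0.
by rewrite expr2; lra.
Qed.

(** An approximate partial isometry from p into the range of c becomes an exact one
    after polar decomposition. *)
Lemma mvn_of_approx x c p t : projection p -> hereditary x c -> selfadjoint c -> c * t = t ->
  cnorm (p - p * (star t * t) * p) < 1 -> mvn_into_hereditary p x.
Proof.
move=> pj xc sc ct /(polar pj)[d [sd pd dp dtd _]].
have sv : star (t * d) * (t * d) = p by rewrite starM sd mulrA -(mulrA d).
exists (t * d * star (t * d)); split; last by exists (t * d).
  split; first by rewrite /selfadjoint starM starK.
  by rewrite -mulrA (mulrA _ (t * d)) sv -(mulrA t) (mulrA d) dp mulrA.
have -> : t * d * star (t * d) = c * (t * d * star (t * d)) * c.
  by rewrite starM -[in LHS]ct starM sc !mulrA.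
exact: hereditaryM.
Qed.

Lemma starM_eq0 x : star x * x = 0 -> x = 0.
Proof.
by move=> E; apply/cnorm0_eq0/eqP; rewrite -sqrf_eq0 -cstar_identity E cnorm0.
Qed.

Lemma mvn_range p q : mvn_equiv p q -> projection p ->
  exists2 t, star t * t = p & q * t = t.
Proof.
move=> [v [vp vq]] [sp pp]; exists v => //.
apply/eqP; rewrite -subr_eq0; apply/eqP/starM_eq0.
rewrite -vq starB !starM starK mulrBr !mulrBl !mulrA vp.
have pvv : p * star v * v = p by rewrite -mulrA vp pp.
by rewrite !pvv !subrr.
Qed.

End Projections.

(** * Consequences of simplicity *)

Section Simple.
Context {R : realType} {A : cstarAlgType R}.
Hypothesis A_simple : simple A.
Implicit Types (x y z h k g p q b c f : A) (r s e : R).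

Lemma ideal_full (I : set A) a : two_sided_ideal I -> limit_closed I ->
  I a -> a <> 0 -> I 1.
Proof.
move=> Iid Il Ia a0; have [I0|->//] := A_simple Iid (closed_limit_closed Il).
by move: Ia; rewrite I0 => /a0.
Qed.

(** The set of all a annihilated by z * b for every b is a closed ideal. *)
Lemma simple_prime z c : (forall a, z * a * c = 0) -> c <> 0 -> z = 0.
Proof.
move=> zc c0; pose I := [set a | forall b, z * b * a = 0].
suff: I 1 by move/(_ 1); rewrite !mulr1.
apply: (@ideal_full _ c) => //; last first.
  move=> a aI b; apply: (@limit_closed_eq _ _ (fun a => z * b * a) (fun=> 0) (cnorm (z * b))).
  - by move=> u v; rewrite -mulrBr cnormM.
  - by move=> u v; rewrite subrr cnorm0 mulr_ge0 ?cnorm_ge0.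
  - by move=> e /aI[v vI av]; exists v => //=; exact: vI.
split=> [b|a a' aI aI' b|a a' aI]; first by rewrite mulr0.
- by rewrite mulrDr aI aI' addr0.
- by split=> b; [rewrite mulrA -(mulrA z) aI | rewrite mulrA aI mul0r].
Qed.

(** If p almost commutes with enough elements, the set of all a for which p a is
    small is an ideal; made uniform in p, it is a closed ideal. It contains q,
    hence it contains 1, so p itself is small. *)
Lemma faithful_commutants q : q <> 0 -> exists (F : set A) (e : R),
  [/\ finite_set F, 0 < e & forall p, projection p ->
    (forall b, F b -> cnorm (p * b - b * p) < e) -> cnorm (p * q) < e -> p = 0].
Proof.
move=> q0; pose I := [set a : A | forall eps : R, 0 < eps -> exists (F : set A) (e : R),
  [/\ finite_set F, 0 < e & forall p, projection p ->
    (forall b, F b -> cnorm (p * b - b * p) < e) -> cnorm (p * q) < e ->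
    cnorm (p * a) < eps]].
suff /(_ 1 ltr01)[F [e [Ff e0 HF]]] : I 1.
  exists F, e; split=> // p pp pF pq; apply: proj_small => //.
  by have := HF p pp pF pq; rewrite mulr1.
apply: (@ideal_full _ q) => //; last 2 first.
- move=> a aI eps eps0; have [|b bI ab] := aI (eps / 2); first by rewrite divr_gt0.
  have [|F [e [Ff e0 HF]]] := bI (eps / 2); first by rewrite divr_gt0.
  exists F, e; split=> // p pp pF pq; have := HF p pp pF pq.
  have -> : p * a = p * b + p * (a - b) by rewrite -mulrDr addrC subrK.
  have := cnormMle (proj_norm_le1 pp) (lexx (cnorm (a - b))); rewrite mul1r.
  by have := cnormD (p * b) (p * (a - b)); lra.
- by move=> eps eps0; exists set0, eps; split=> // p _ _.
split=> [eps eps0|a b aI bI eps eps0|a b bI].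
- by exists set0, 1; split=> // p _ _ _; rewrite mulr0 cnorm0.
- have e20 : 0 < eps / 2 by rewrite divr_gt0.
  have [F [e [Ff e0 HF]]] := aI _ e20; have [G [d [Gf d0 HG]]] := bI _ e20.
  exists (F `|` G), (Num.min e d); split; [by rewrite finite_setU | by rewrite lt_min e0|].
  move=> p pp pFG; rewrite lt_min => /andP[pe pd]; rewrite mulrDr.
  have := HF p pp _ pe; have := HG p pp _ pd => H1 H2.
  have {}H1 : cnorm (p * b) < eps / 2.
    by apply: H1 => c Gc; have := pFG c (or_intror Gc); rewrite lt_min => /andP[].
  have {}H2 : cnorm (p * a) < eps / 2.
    by apply: H2 => c Fc; have := pFG c (or_introl Fc); rewrite lt_min => /andP[].
  by have := cnormD (p * a) (p * b); lra.
split=> eps eps0.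
- have n0 := cnorm_ge0 a; have m0 := cnorm_ge0 b.
  pose C := cnorm a + cnorm b + 1; have C0 : 0 < C by rewrite /C; lra.
  have [|F [e [Ff e0 HF]]] := bI (eps / (2 * C)); first by rewrite divr_gt0 ?mulr_gt0.
  exists (a |` F), (Num.min e (eps / (2 * C))); split.
  + by rewrite finite_setU; split=> //; exact: finite_set1.
  + by rewrite lt_min e0 divr_gt0 ?mulr_gt0.
  move=> p pp pF; rewrite lt_min => /andP[pe _].
  have pb : cnorm (p * b) < eps / (2 * C).
    by apply: HF => // c Fc; have := pF c (or_intror Fc); rewrite lt_min => /andP[].
  have := pF a (or_introl erefl); rewrite lt_min => /andP[_ pa].
  have -> : p * (a * b) = (p * a - a * p) * b + a * (p * b) by ncring.
  have := cnormD ((p * a - a * p) * b) (a * (p * b)).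
  have := cnormMle (ltW pa) (lexx (cnorm b)).
  have := cnormMle (lexx (cnorm a)) (ltW pb).
  have E : eps / (2 * C) * C = eps / 2 by field; rewrite lt0r_neq0.
  have D0 : 0 < eps / (2 * C) by rewrite divr_gt0 ?mulr_gt0.
  by move: E; rewrite {2}/C; lra.
- have n0 := cnorm_ge0 b.
  have [|F [e [Ff e0 HF]]] := bI (eps / (cnorm a + 1)).
    by rewrite divr_gt0 // ltr_wpDl ?cnorm_ge0.
  exists F, e; split=> // p pp pF pq; rewrite mulrA.
  have := HF p pp pF pq; rewrite ltr_pdivlMr ?ltr_wpDl ?cnorm_ge0 //.
  have := cnormM (p * b) a; have := cnorm_ge0 (p * b); lra.
Qed.

(** The usual property (SP), tested on positive elements of norm 1 only. *)
Definition property_SP : Prop := forall x, positive x -> cnorm x = 1 ->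
  exists q, [/\ projection q, q <> 0 & hereditary x q].

Lemma hereditary_annr x q b : hereditary x q -> b * x = 0 -> b * q = 0.
Proof.
move=> /closure_approx xq bx.
apply: (@limit_closed_eq _ _ (fun a => b * a) (fun=> 0) (cnorm b)).
- by move=> u v; rewrite -mulrBr cnormM.
- by move=> u v; rewrite subrr cnorm0 mulr_ge0 ?cnorm_ge0.
- by move=> e /xq[_ [a _ <-] qa]; exists (x * a * x) => //=; rewrite !mulrA bx !mul0r.
Qed.

Lemma hereditary_absorb x q z : hereditary x q -> z * x = x -> z * q = q.
Proof.
move=> xq zx; apply/eqP; rewrite eq_sym -subr_eq0 -{1}[q]mul1r -mulrBl; apply/eqP.
by apply: (hereditary_annr xq); rewrite mulrBl mul1r zx subrr.
Qed.

Lemma closureS (I J : set A) : I `<=` J ->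
  closure (I : set (normed_space A)) `<=` closure (J : set (normed_space A)).
Proof.
move=> IJ a /closure_approx aI; apply/closure_approx => e /aI[b Ib ab].
by exists b => //; exact: IJ.
Qed.

Lemma SP_square f : property_SP -> selfadjoint f -> f <> 0 ->
  exists q, [/\ projection q, q <> 0 & hereditary (f * f) q].
Proof.
move=> SP sf /cnorm_gt0 f0; pose l := (cnorm f)^-1%:C.
have sF : selfadjoint (l *: f) by rewrite /selfadjoint starZr sf.
have [|q [qp q0 qh]] := SP _ (sq_positive sF).
  rewrite cnorm_sq // cnormZr ger0_norm ?invr_ge0 ?cnorm_ge0 //.
  by rewrite mulVf ?expr1n // lt0r_neq0.
exists q; split=> //; apply: closureS qh => _ [a _ <-].
exists ((l * l * (l * l)) *: a) => //.
by rewrite -!scalerAl -!scalerAr -!scalerAl !scalerA !mulrA.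
Qed.

(** By simplicity t = z a c is nonzero for some a. The orthogonality of z and c makes
    y = t + star t satisfy z y^2 z = t (star t), so t (star t) has a square root l
    in the corner of z. A projection in the hereditary subalgebra of l^2 is
    approximately (star w) w with w = l^2 b l^2, and this is (star v) v with
    v = (star t) l b l^2 in c A. *)
Lemma comparison z c : property_SP -> projection z -> projection c ->
  z <> 0 -> c <> 0 -> z * c = 0 ->
  exists z1 u : A, [/\ projection z1, z1 <> 0, z * z1 = z1, star u * u = z1 & c * u = u].
Proof.
move=> SP [sz zz] [sc cc] z0 c0 zc.
have cz : c * z = 0 by rewrite -sc -sz -starM zc star0.
have [a t0] : exists a, z * a * c <> 0.
  apply: contrapT => /forallNP H; apply: z0; apply: (@simple_prime _ c) => // a.
  exact: contrapT (H a).
pose k := (2 * cnorm (z * a * c))^-1; pose t := k%:C *: (z * a * c).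
have n0 := cnorm_gt0 t0.
have k0 : 0 < k by rewrite invr_gt0 mulr_gt0.
have tn : cnorm t = 1 / 2.
  by rewrite cnormZr gtr0_norm // /k; field; rewrite lt0r_neq0.
have zt : z * t = t by rewrite /t -scalerAr !mulrA zz.
have tz : t * z = 0 by rewrite /t -scalerAl -(mulrA _ c) cz mulr0 scaler0.
have tc : t * c = t by rewrite /t -scalerAl -(mulrA _ c) cc.
clearbody t.
have ct : c * star t = star t by rewrite -{1}sc -starM tc.
have tz' : star t * z = star t by rewrite -{1}sz -starM zt.
have zt' : z * star t = 0 by rewrite -{1}sz -starM tz star0.
pose y := t + star t.
have sy : selfadjoint y by rewrite /selfadjoint starD starK addrC.
have y1 : cnorm y <= 1 by have := cnormD t (star t); rewrite cnorm_star tn /y; lra.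
have zyyz : z * (1 - y * y) * z = z - t * star t.
  have -> : z * (1 - y * y) * z = z * z - (z * y) * (y * z) by ncring.
  have -> : z * y = t by rewrite mulrDr zt zt' addr0.
  by rewrite zz mulrDl tz tz' add0r.
have [||g [sg g2 _ gC _]] := @csqrt _ _ (z - t * star t).
- by rewrite /selfadjoint starB starM starK sz.
- rewrite -zyyz; have zp : projection z by [].
  have := cnormMle (cnormMle (proj_norm_le1 zp) (norm_1Bsq sy y1)) (proj_norm_le1 zp).
  by rewrite !mulr1.
have zg : z * g = g * z.
  by apply: gC; rewrite mulrBr mulrBl mulrA zt -mulrA tz'.
pose l := z * g.
have sl : selfadjoint l by rewrite /selfadjoint /l starM sz sg -zg.
have ll : l * l = t * star t.
  rewrite /l {2}zg mulrA -(mulrA z) g2.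
  have -> : z * (1 - (z - t * star t)) * z = z * z - z * z * z + (z * t) * (star t * z).
    by ncring.
  by rewrite zt tz' !zz subrr add0r.
have zl : z * l = l by rewrite /l mulrA zz.
clearbody l.
have l0 : l <> 0.
  move=> l0; have : star (star t) * star t = 0 by rewrite starK -ll l0 mulr0.
  move=> /starM_eq0 /(congr1 cnorm); rewrite cnorm_star tn cnorm0; lra.
have [z1 [pz1 z10 hz1]] := SP_square SP sl l0.
have zz1 : z * z1 = z1 by apply: hereditary_absorb hz1 _; rewrite mulrA zl.
have [|_ [b _ <-] wn] := (closure_approx _ _).1 hz1 (1 / 4); first by rewrite divr_gt0.
(* the factor l of w next to t (star t) = l l is what lets w be rewritten as v *)
pose w := l * l * b * (l * l).
pose v := star t * (l * b * (l * l)).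
have vv : star v * v = star w * w.
  by rewrite /v /w !starM !starK sl !mulrA -(mulrA _ t) -ll !mulrA.
have [sz1 z1z1] := pz1.
have [||d [sd _ _ dvd _]] := @polar _ _ z1 v => //.
  rewrite vv; have -> : z1 - z1 * (star w * w) * z1 =
    z1 * (star (z1 - w) * z1 + z1 * (z1 - w) - star (z1 - w) * (z1 - w)) * z1.
    by rewrite starB sz1 !(mulrBl, mulrBr, mulrDr, mulrDl) !mulrA !z1z1; ncring.
  move: wn; rewrite -/w; set u := z1 - w => un.
  have u1 : cnorm (star u) <= 1 / 4 by rewrite cnorm_star ltW.
  have p1 := proj_norm_le1 pz1.
  have : cnorm (star u * z1 + z1 * u - star u * u) <= 9 / 16.
    have := cnormB (star u * z1 + z1 * u) (star u * u).
    have := cnormD (star u * z1) (z1 * u).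
    have := cnormMle u1 p1; have := cnormMle p1 (ltW un); have := cnormMle u1 (ltW un); lra.
  by move=> /(cnormMle p1) /cnormMle /(_ p1); lra.
exists z1, (v * d); split=> //; last by rewrite /v !mulrA ct.
by rewrite starM sd mulrA -(mulrA d).
Qed.

End Simple.

(** * A projection where x is almost of full norm *)

Section TopCut.
Context {R : realType} {A : cstarAlgType R}.
Implicit Types (x y z h k g p q b c f : A) (r s e : R).

(** The projection is found in the hereditary subalgebra of f^2, where y = (x^2 - s) / 4,
    g is the modulus of y, and f = g + y is twice its positive part. On it y acts as g,
    so x^2 acts as s + 4 g, which is at least s; since s + 4 g is invertible, f lies
    in x A x. *)
Lemma top_cut x s : @property_SP R A -> selfadjoint x -> cnorm x = 1 -> 0 < s < 1 ->
  exists q, [/\ projection q, q <> 0, hereditary x q &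
    forall z, projection z -> z <> 0 -> q * z = z -> s <= cnorm (z * (x * x) * z)].
Proof.
move=> SP sx x1 /andP[s0 s1].
pose S : A := s%:C%:A.
have SC a : S * a = a * S by rewrite /S scalar_mull scalar_mulr.
have Sn : cnorm S = s by rewrite cnormZr cnorm1 mulr1 gtr0_norm.
have sS : selfadjoint S by rewrite /selfadjoint starZr star1.
have SE : S = s%:C%:A by [].
clearbody S.
(* the factor 1/4 keeps y in the unit ball and makes 4 g a square, of 2 k, below *)
pose y := (4^-1)%:C *: (x * x - S).
have y4 : y *+ 4 = x * x - S.
  by rewrite scalerMnl -rmorphMn /= -[_ *+ 4]mulr_natl divff ?scale1r // pnatr_eq0.
have yn : cnorm y <= 1.
  rewrite cnormZr gtr0_norm ?invr_gt0 //.
  by have := cnormB (x * x) S; rewrite Sn cnorm_sq // x1; lra.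
have sy : selfadjoint y by rewrite /selfadjoint starZr starB starM sx sS.
have yC b : b * x = x * b -> b * y = y * b.
  move=> bx; rewrite -scalerAr -scalerAl; congr (_ *: _).
  by rewrite mulrBr mulrBl -SC !mulrA bx -mulrA bx mulrA.
clearbody y.
have sh : selfadjoint (1 - y * y) by rewrite /selfadjoint starB star1 starM sy.
have [g [sg g2 gn gC _]] := csqrt sh (norm_1Bsq sy yn).
rewrite subKr in g2.
have {}gn : cnorm (1 - g) <= 1 by apply: (le_trans gn); exact: norm_1Bsq.
have {}gC b : b * y = y * b -> b * g = g * b.
  by move=> yb; apply: gC; rewrite mulrBl mulrBr mulr1 mul1r !mulrA yb -mulrA yb mulrA.
have gy : g * y = y * g by apply/esym/gC.
have gx : x * g = g * x by apply/gC/yC.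
have xy : x * y = y * x by apply/yC.
pose f := g + y.
have sf : selfadjoint f by rewrite /selfadjoint starD sg sy.
have fx : f * x = x * f by rewrite /f mulrDl mulrDr gx xy.
have gyf : (g - y) * f = 0.
  have -> : (g - y) * f = g * g - y * y + (g * y - y * g) by rewrite /f; ncring.
  by rewrite g2 gy !subrr addr0.
have f0 : f <> 0.
  (* if f = 0 then x^2 + 4 g = s, and s would dominate the norm of x^2 *)
  move=> f0; have yg : y = - g by apply/eqP; rewrite -addr_eq0 addrC -/f f0.
  have [||k [sk k2 _ kC _]] := @csqrt _ _ (1 - g) => //.
    by rewrite /selfadjoint starB star1 sg.
  rewrite subKr in k2.
  have xk : x * k = k * x by apply: kC; rewrite mulrBl mulrBr mulr1 mul1r gx.
  have := @comm_sq_le _ _ x (k *+ 2) sx.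
  rewrite /selfadjoint mulr2n starD sk => /(_ erefl).
  rewrite mulrDr mulrDl xk => /(_ erefl).
  have -> : x * x + (k + k) * (k + k) = S.
    have -> : (k + k) * (k + k) = (k * k) *+ 4 by rewrite (mulrnA _ 2 2) !mulr2n; ncring.
    by rewrite k2 -[g]opprK -yg mulNrn y4 subKr.
  by rewrite Sn x1 expr1n; lra.
have [q [pq q0 qh]] := SP_square SP sf f0.
(* s + 4 g is invertible because 1 - g has norm at most 1 *)
have x2f : x * x * f = (S + g *+ 4) * f.
  have -> : x * x = S + g *+ 4 - (g - y) *+ 4 by rewrite mulrnBl y4 [RHS]addrAC; ncring.
  by rewrite mulrBl mulrnAl gyf mul0rn subr0.
have [b [Sb bS]] : invertible (S + g *+ 4).
  have s4 : s + 4 != 0 by rewrite lt0r_neq0 //; lra.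
  have -> : S + g *+ 4 = (s + 4)%:C *: (1 - (4 / (s + 4))%:C *: (1 - g)).
    rewrite scalerBr scalerA -rmorphM mulrC divfK // rmorphD scalerDl -SE /=.
    by rewrite rmorph_nat !scaler_nat mulrnBl -addrA subKr.
  apply: invertibleZ; first by rewrite eq_complex /= negb_and s4.
  apply: neumann; rewrite cnormZr gtr0_norm ?divr_gt0 //; last by lra.
  rewrite mulrAC ltr_pdivrMr; last by lra.
  by lra.
exists q; split=> //.
  have bx : b * x = x * b.
    apply/esym; apply: (inverse_comm Sb bS).
    by rewrite mulrDr mulrDl SC mulrnAl mulrnAr gx.
  have fE : f = x * (b * f) * x.
    by rewrite -[f in LHS]mul1r -bS -mulrA -x2f !mulrA bx -!mulrA fx.
  apply: closureS qh => _ [a _ <-].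
  exists (b * f * x * f * a * (f * x * (b * f))) => //.
  have -> : f * f * a * (f * f) = (x * (b * f) * x) * f * a * (f * (x * (b * f) * x)).
    by rewrite -fE.
  by rewrite !mulrA.
move=> z pz z0 qz.
have gyz : (g - y) * z = 0.
  rewrite -qz mulrA (@hereditary_annr _ _ (f * f) q) ?mul0r //.
  by rewrite mulrA gyf mul0r.
(* 4 (1 - g) has norm at most 4 on z, so z x^2 z cannot be smaller than s *)
have E : (S + 1 *+ 4) * z = (z * (1 - g) * z) *+ 4 + z * (x * x) * z.
  have -> : x * x = S + g *+ 4 - (g - y) *+ 4 by rewrite mulrnBl y4 [RHS]addrAC; ncring.
  case: pz => _ zz.
  have -> : z * (S + g *+ 4 - (g - y) *+ 4) * z =
      z * S * z + (z * g * z) *+ 4 - (z * ((g - y) * z)) *+ 4.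
    by rewrite !(mulrnA _ 2 2); ncring.
  have -> : z * (1 - g) * z = z - z * g * z by rewrite mulrBr mulrBl mulr1 zz.
  by rewrite gyz mulr0 mul0rn subr0 -SC -(mulrA S) zz !(mulrnA _ 2 2); ncring.
have SzE : (S + 1 *+ 4) * z = (s + 4)%:C *: z.
  by rewrite SE rmorphD scalerDl mulrDl scalar_mull mulrnAl mul1r -scaler_nat rmorph_nat.
have := cnormD ((z * (1 - g) * z) *+ 4) (z * (x * x) * z); rewrite -E cnormMn SzE.
have := cnormMle (cnormMle (proj_norm_le1 pz) gn) (proj_norm_le1 pz).
rewrite cnormZr (proj_norm1 pz z0) gtr0_norm ?addr_gt0 // !mulr1 -mulr_natr.
by move=> ? ?; lra.
Qed.
End TopCut.

(** * Room for the complements *)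

Section Reserves.
Context {R : realType} {A : cstarAlgType R}.
Hypothesis A_simple : simple A.
Implicit Types (x y z h k p q b c f : A) (r s e : R).

Lemma finite_setU1 (F : set A) a : finite_set F -> finite_set (a |` F).
Proof. by move=> Ff; rewrite finite_setU; split=> //; exact: finite_set1. Qed.

(** z' is the projection close to z p z, which is almost idempotent because p almost
    commutes with z. *)
Lemma cut_down z p e : projection z -> projection p ->
  cnorm (p * z - z * p) < e -> e <= 1 / 8 -> exists z',
  [/\ projection z', z * z' = z', cnorm (z' - z * p * z) <= 2 * e &
      cnorm (p * z' - z') <= 5 * e].
Proof.
move=> pz pp pze e8; have [sz zz] := pz; have [sp ppp] := pp.
have z1 := proj_norm_le1 pz; have p1 := proj_norm_le1 pp.
pose a := z * p * z.
have aa : cnorm (a * a - a) <= e.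
  have -> : a * a - a = (z * p * (z * p - p * z)) * z + (z * p * (z * z - z) * p * z + z * (p * p - p) * z + z * p * p * (z * z - z)).
    by rewrite /a; ncring.
  rewrite zz ppp !subrr !(mulr0, mul0r) !addr0.
  have -> : z * p * (z * p - p * z) * z = - (z * p * (p * z - z * p) * z) by ncring.
  rewrite cnormN; have := cnormMle (cnormMle (cnormMle z1 p1) (ltW pze)) z1.
  by rewrite !mul1r mulr1.
have [||z' [pz' za ann]] := @near_projection _ _ a.
- by rewrite /selfadjoint !starM sz sp mulrA.
- by have := cnorm_ge0 (a * a - a); lra.
have zz' : z * z' = z'.
  apply/eqP; rewrite eq_sym -subr_eq0 -{1}[z']mul1r -mulrBl; apply/eqP/ann.
  by rewrite mulrBl mul1r /a !mulrA zz subrr.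
exists z'; split=> //; first by rewrite -/a; lra.
have pa : cnorm (p * a - a) <= e.
  have -> : p * a - a = (p * z - z * p) * (p * z) + (z * (p * p - p) * z).
    by rewrite /a; ncring.
  rewrite ppp subrr mulr0 mul0r addr0.
  by have := cnormMle (ltW pze) (cnormMle p1 z1); rewrite !mulr1.
have -> : p * z' - z' = p * (z' - a) + (p * a - a) - (z' - a) by ncring.
have := cnormB (p * (z' - a) + (p * a - a)) (z' - a).
have := cnormD (p * (z' - a)) (p * a - a).
have := cnormMle p1 za; lra.
Qed.

(** What the two tracial conditions have in common: data d with a projection E d and
    some further approximate property P that improves as F grows and eps shrinks. *)
Definition tracial_family (D : Type) (E : D -> A) (P : set A -> R -> D -> Prop) : Prop :=
  (forall (F F' : set A) (eps eps' : R) d, F `<=` F' -> eps' <= eps -> P F' eps' d -> P F eps d) /\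
  forall F eps x, finite_set F -> 0 < eps -> positive x -> cnorm x = 1 ->
  exists d, [/\ projection (E d), P F eps d,
    forall a, F a -> cnorm (E d * a - a * E d) < eps,
    mvn_into_hereditary (1 - E d) x & 1 - eps < cnorm (E d * x * E d)].

(** For tests z in K, a tracial family can be asked to put the complement of its
    projection under c, through the partial isometry t, while a test z' below z
    almost survives under the projection, so that the process can be repeated. *)
Definition reserve (K : set A) c : Prop :=
  forall (D : Type) (E : D -> A) P, tracial_family E P ->
  forall F eps z, finite_set F -> 0 < eps -> K z ->
  exists d t z', [/\ projection (E d), P F eps d,
      forall a, F a -> cnorm (E d * a - a * E d) < eps &
    [/\ star t * t = 1 - E d, c * t = t, K z', z * z' = z' & cnorm (E d * z' - z') < eps]].

(** The family is tested not against z but against a projection z1 below z that is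
    equivalent to a subprojection of c. *)
Lemma reserve_SP z0 c : @property_SP R A -> projection z0 -> projection c ->
  c <> 0 -> z0 * c = 0 ->
  reserve [set z | [/\ projection z, z <> 0 & z0 * z = z]] c.
Proof.
move=> SP pz0 pc c0 z0c D E P [Pmono PE] F eps z Ff eps0 [pz z_0 z0z].
have zc : z * c = 0.
  have [[sz _] [sz0 _]] := (pz, pz0).
  by rewrite -sz -z0z starM sz0 -mulrA z0c mulr0.
have [z1 [u [pz1 z10 zz1 uu cu]]] := comparison A_simple SP pz pc z_0 c0 zc.
pose e := Num.min (eps / 6) (1 / 8).
have e0 : 0 < e by rewrite lt_min !divr_gt0.
have e8 : e <= 1 / 8 by rewrite ge_min lexx orbT.
have e6 : e <= eps / 6 by rewrite ge_min lexx.
have [d [pE PFd com [q [pq qh mvn]] big]] :=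
  PE _ _ _ (finite_setU1 z1 Ff) e0 (proj_positive pz1) (proj_norm1 pz1 z10).
have [t tt qt] := mvn_range mvn (projC pE).
have zt : z1 * t = t.
  by rewrite -qt mulrA (hereditary_absorb qh) //; case: pz1.
have [z' [pz' z1z' z'a Ez']] := cut_down pz1 pE (com _ (or_introl erefl)) e8.
exists d, (u * t), z'; split=> //.
- by apply: Pmono PFd; [move=> ? ?; right | lra].
- by move=> a Fa; have := com a (or_intror Fa); lra.
split.
- by rewrite starM mulrA -(mulrA (star t)) uu -mulrA zt.
- by rewrite mulrA cu.
- split=> //; last by rewrite -z1z' mulrA -zz1 mulrA z0z.
  move=> z'0; move: z'a; rewrite z'0 sub0r cnormN => zEz.
  have [_ EE] := pE; have [_ zz] := pz1.
  have := com z1 (or_introl erefl); set w := _ - _ => wn.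
  have : E d * z1 * E d = z1 * E d * z1 + (w - z1 * w - E d * w) + (E d * E d - E d) * z1 - (z1 * z1 - z1) * E d.
    by rewrite /w; ncring.
  rewrite EE zz !subrr !mul0r addr0 subr0 => EzE.
  move: big; rewrite EzE.
  have := cnormD (z1 * E d * z1) (w - z1 * w - E d * w).
  have := cnormB (w - z1 * w) (E d * w); have := cnormB w (z1 * w).
  have := cnormMle (proj_norm_le1 pz1) (ltW wn).
  have := cnormMle (proj_norm_le1 pE) (ltW wn); lra.
- by rewrite -z1z' mulrA zz1.
- lra.
Qed.

(** Without projections to receive it, the complement has to be 0. *)
Lemma reserve0 x0 : positive x0 -> cnorm x0 = 1 ->
  (forall q, projection q -> hereditary x0 q -> q = 0) -> reserve [set 1] 0.
Proof.
move=> px0 nx0 no D E P [_ PE] F eps z Ff eps0 ->.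
have [d [pE PFd com [q [pq qh mvn]] _]] := PE _ _ _ Ff eps0 px0 nx0.
have [t tt qt] := mvn_range mvn (projC pE).
have t0 : t = 0 by rewrite -qt (no q) // mul0r.
have E1 : E d = 1 by apply/esym/eqP; rewrite -subr_eq0 -tt t0 mulr0.
by exists d, t, 1; split=> //; split; rewrite // ?t0 ?mulr0 ?mulr1 ?E1 ?subrr ?cnorm0.
Qed.

(** If q could not be split, each Rokhlin projection p_g would almost commute with q
    and cut it trivially, so that p_g or 1 - p_g is almost orthogonal to q, and
    [faithful_commutants] makes p_g equal to 0 or 1. If some p_g is 1, the others
    are 0, which the action contradicts as there are at least two of them; and they
    cannot all be 0, since their sum does not annihilate q. *)
Lemma split_projection (gT : finGroupType) (gamma : autAction gT A) (g0 h0 : gT) q :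
  tracial_Rokhlin gamma -> g0 != h0 -> projection q -> q <> 0 ->
  exists z, [/\ projection z, z <> 0, z <> q & q * z = z].
Proof.
move=> Rok gh pq q0; apply: contrapT => nsplit.
have trivial_sub z : projection z -> q * z = z -> z = 0 \/ z = q.
  move=> pz qz; have [->|/eqP z0] := eqVneq z 0; [by left|right].
  by have [//|/eqP zq] := eqVneq z q; case: nsplit; exists z.
have [F [e [Ff e0 HF]]] := faithful_commutants A_simple q0.
pose d := Num.min (e / 4) (1 / 8).
have d0 : 0 < d by rewrite lt_min !divr_gt0.
have d8 : d <= 1 / 8 by rewrite ge_min lexx orbT.
have de : d <= e / 4 by rewrite ge_min lexx.
have [p [pp orth [pg com _ big]]] :=
  Rok _ _ _ (finite_setU1 q Ff) d0 (proj_positive pq) (proj_norm1 pq q0).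
have p01 g : p g = 0 \/ p g = 1.
  have [_ qq] := pq.
  have [z [pz qz zpq _]] := cut_down pq (pp g) (com g q (or_introl erefl)) d8.
  have cq := com g q (or_introl erefl).
  have near : cnorm (p g * q - q * p g * q) <= d.
    have -> : p g * q - q * p g * q = (p g * q - q * p g) * q - p g * (q * q - q).
      by ncring.
    rewrite qq subrr mulr0 subr0.
    by have := cnormMle (ltW cq) (proj_norm_le1 pq); rewrite mulr1.
  have [z0|zq] := trivial_sub z pz qz; [left|right].
    apply: HF => [//|b Fb|]; first by have := com g b (or_intror Fb); lra.
    have := cnorm_le_dist (p g * q) (q * p g * q).
    by move: zpq; rewrite z0 sub0r cnormN; lra.
  suff : 1 - p g = 0 by move=> /eqP; rewrite subr_eq0 => /eqP.
  apply: HF; first exact: projC.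
    move=> b Fb; have := com g b (or_intror Fb).
    have -> : (1 - p g) * b - b * (1 - p g) = - (p g * b - b * p g) by ncring.
    by rewrite cnormN; lra.
  have -> : (1 - p g) * q = (z - q * p g * q) - (p g * q - q * p g * q).
    by rewrite zq; ncring.
  by have := cnormB (z - q * p g * q) (p g * q - q * p g * q); lra.
have [[g g1]|no1] := pselect (exists g, p g = 1).
  have [h hg] : exists h : gT, g != h.
    by have [E|gg] := eqVneq g g0; [exists h0; rewrite E | exists g0].
  have h_0 : p h = 0 by rewrite -[p h]mul1r -g1 orth.
  have := pg (h * g^-1)%g g; rewrite g1 rmorph1 -mulgA mulVg mulg1 h_0 subr0 cnorm1; lra.
have : \sum_g p g = 0.
  apply: big1 => g _; case: (p01 g) => // g1; by case: no1; exists g.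
by move: big => /[swap] ->; rewrite mul0r mul0r cnorm0; lra.
Qed.

Lemma split_two (gT : finGroupType) (gamma : autAction gT A) (g0 h0 : gT) q :
  tracial_Rokhlin gamma -> g0 != h0 -> projection q -> q <> 0 ->
  exists z c, [/\ projection z, projection c, z <> 0, c <> 0 &
    [/\ z * c = 0, q * z = z & q * c = c]].
Proof.
move=> Rok gh pq q0; have [z [pz z0 zq qz]] := split_projection Rok gh pq q0.
have [[sq qq] [sz zz]] := (pq, pz).
have zq' : z * q = z by rewrite -{1}sz -sq -starM qz sz.
exists z, (q - z); split=> //.
- split; first by rewrite /selfadjoint starB sq sz.
  by rewrite mulrBr !mulrBl qq zz qz zq' subrr subr0.
- by move/eqP; rewrite subr_eq0 => /eqP /esym.
- by split=> //; rewrite mulrBr ?zz ?zq' ?qz ?qq ?subrr.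
Qed.

(** Either all remainders vanish and 1 is the only test, or the projection of
    [top_cut] is split into a test z and three receivers. *)
Lemma reservoir (gT : finGroupType) (gamma : autAction gT A) (g0 h0 : gT) x s :
  tracial_Rokhlin gamma -> g0 != h0 -> positive x -> cnorm x = 1 -> 0 < s < 1 ->
  exists (K : set A) z c1 c2 c3, [/\ K z,
    forall z, K z -> projection z /\ s <= cnorm (z * (x * x) * z),
    [/\ projection c1, projection c2 & projection c3],
    [/\ c1 * c2 = 0, c1 * c3 = 0 & c2 * c3 = 0] &
    [/\ reserve K c1, reserve K c2, reserve K c3 &
        [/\ hereditary x c1, hereditary x c2 & hereditary x c3]]].
Proof.
move=> Rok gh px x1 s01; have [sx _] := px.
have [SP|nSP] := pselect (@property_SP R A); last first.
  have [x0 [px0 nx0 no]] : exists x0, [/\ positive x0, cnorm x0 = 1 &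
      forall q, projection q -> hereditary x0 q -> q = 0].
    apply: contrapT => /forallNP H; apply: nSP => y py ny.
    apply: contrapT => /forallNP no; apply: (H y); split=> // q pq hq.
    by have [//|/eqP q0] := eqVneq q 0; case: (no q).
  have r0 := reserve0 px0 nx0 no.
  have p0 : projection (0 : A) by split; [exact: star0 | rewrite mulr0].
  have h_0 : hereditary x 0.
    by apply/closure_approx => e e0; exists 0; [exists 0; rewrite ?mulr0 ?mul0r | rewrite subrr cnorm0].
  exists [set 1], 1, 0, 0, 0; split=> //; rewrite ?mulr0 //.
  move=> z ->; split; first by split; [exact: star1 | rewrite mulr1].
  by rewrite mulr1 mul1r cnorm_sq // x1; lra.
have [q [pq q0 qh topq]] := top_cut SP sx x1 s01.
have [z [u [pz pu z0 u0 [zu qz qu]]]] := split_two Rok gh pq q0.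
have [c1 [v [pc1 pv c10 v0 [c1v uc1 uv]]]] := split_two Rok gh pu u0.
have [c2 [c3 [pc2 pc3 c20 c30 [c23 vc2 vc3]]]] := split_two Rok gh pv v0.
have zv : z * v = 0 by rewrite -uv mulrA zu mul0r.
have under c : projection c -> q * c = c -> hereditary x c.
  move=> [sc cc] qc; have [sq _] := pq.
  have cq : c * q = c by rewrite -{1}sc -sq -starM qc.
  by rewrite -cq -{1}qc; exact: hereditaryM.
exists [set z' | [/\ projection z', z' <> 0 & z * z' = z']], z, c1, c2, c3; split=> //.
- by split=> //; case: pz.
- move=> z' [pz' z'0 zz']; split=> //; apply: topq => //.
  by rewrite -zz' mulrA qz.
- by split=> //; [rewrite -vc2 mulrA c1v mul0r | rewrite -vc3 mulrA c1v mul0r].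
split.
- by apply: reserve_SP => //; rewrite -uc1 mulrA zu mul0r.
- by apply: reserve_SP => //; rewrite -vc2 mulrA zv mul0r.
- by apply: reserve_SP => //; rewrite -vc3 mulrA zv mul0r.
have qv : q * v = v by rewrite -uv mulrA qu.
split; apply: under => //; first by rewrite -uc1 mulrA qu.
  by rewrite -vc2 mulrA qv.
by rewrite -vc3 mulrA qv.
Qed.

End Reserves.

(** * Bounded sequences modulo null sequences *)

Section SeqAlgebra.
Context {R : realType} {A : cstarAlgType R}.

Definition bounded_seq : {pred nat -> A} :=
  fun u : nat -> A => `[< exists M : R, forall m, cnorm (u m) <= M >].

Lemma bounded_seqP (u : nat -> A) : reflect (exists M : R, forall m, cnorm (u m) <= M) (u \in bounded_seq).
Proof. exact: asboolP. Qed.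

Lemma bounded_seq_subring : subring_closed bounded_seq.
Proof.
split.
- by apply/bounded_seqP; exists 1 => m; rewrite cnorm1.
- move=> u v /bounded_seqP[M HM] /bounded_seqP[M' HM']; apply/bounded_seqP.
  by exists (M + M') => m; apply: (le_trans (cnormB _ _)); rewrite lerD.
- move=> u v /bounded_seqP[M HM] /bounded_seqP[M' HM']; apply/bounded_seqP.
  by exists (M * M') => m; exact: cnormMle.
Qed.

HB.instance Definition _ := GRing.isSubringClosed.Build (nat -> A) bounded_seq
  bounded_seq_subring.

Record bddseq := BSeq { bfun :> nat -> A; bfunP : bfun \in bounded_seq }.
HB.instance Definition _ := [isSub for bfun].
HB.instance Definition _ := [Choice of bddseq by <:].
HB.instance Definition _ :=
  GRing.SubChoice_isSubPzRing.Build (nat -> A) bounded_seq bddseq bounded_seq_subring.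

Local Open Scope quotient_scope.

Definition null_seq : {pred bddseq} :=
  fun u : bddseq => `[< forall e : R, 0 < e -> \forall m \near \oo, cnorm (u m) < e >].

Lemma null_seqP (u : bddseq) :
  reflect (forall e : R, 0 < e -> \forall m \near \oo, cnorm (u m) < e) (u \in null_seq).
Proof. exact: asboolP. Qed.

Lemma null_seq_zmod : zmod_closed null_seq.
Proof.
split.
- by apply/null_seqP => e e0; near=> m; rewrite cnorm0.
- move=> u v /null_seqP Hu /null_seqP Hv; apply/null_seqP => e e0.
  have e20 : 0 < e / 2 by rewrite divr_gt0.
  near=> m; apply: (le_lt_trans (cnormB _ _)); rewrite [e]splitr; apply: ltrD; near: m.
    exact: Hu. exact: Hv.
Unshelve. all: by end_near. Qed.

HB.instance Definition _ := GRing.isZmodClosed.Build bddseq null_seq null_seq_zmod.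

Lemma null_seqMl (u v : bddseq) : v \in null_seq -> u * v \in null_seq.
Proof.
move=> /null_seqP Hv; apply/null_seqP => e e0.
have /bounded_seqP[M HM] := bfunP u.
have M0 : 0 <= M := le_trans (cnorm_ge0 _) (HM 0%N).
have e20 : 0 < e / (M + 1) by rewrite divr_gt0 // ltr_wpDl.
near=> m; have : cnorm (v m) < e / (M + 1) by near: m; exact: Hv.
move=> vm; apply: (@le_lt_trans _ _ (M * (e / (M + 1)))).
  by apply: cnormMle; [exact: HM | exact: ltW].
rewrite mulrA ltr_pdivrMr ?ltr_wpDl // mulrDr mulr1 mulrC; lra.
Unshelve. all: by end_near. Qed.

Lemma null_seqMr (u v : bddseq) : v \in null_seq -> v * u \in null_seq.
Proof.
move=> /null_seqP Hv; apply/null_seqP => e e0.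
have /bounded_seqP[M HM] := bfunP u.
have M0 : 0 <= M := le_trans (cnorm_ge0 _) (HM 0%N).
have e20 : 0 < e / (M + 1) by rewrite divr_gt0 // ltr_wpDl.
near=> m; have : cnorm (v m) < e / (M + 1) by near: m; exact: Hv.
move=> vm; apply: (@le_lt_trans _ _ (e / (M + 1) * M)).
  by apply: cnormMle; [exact: ltW | exact: HM].
rewrite mulrAC ltr_pdivrMr ?ltr_wpDl // mulrDr mulr1; lra.
Unshelve. all: by end_near. Qed.

(** The algebra of bounded sequences modulo null sequences, l^oo(A) / c_0 (A). *)
Definition asymp := Quotient.quot null_seq.
HB.instance Definition _ := GRing.Zmodule.on asymp.

Definition cls (u : bddseq) : asymp := \pi_(Quotient.quot null_seq) u.

Lemma cls_eq (u v : bddseq) : cls u = cls v <->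
  forall e : R, 0 < e -> \forall m \near \oo, cnorm (u m - v m) < e.
Proof.
rewrite /cls; split => [/eqP|H]; last apply/eqP; rewrite -Quotient.idealrBE.
  by move=> /null_seqP.
exact/null_seqP.
Qed.

Lemma cls_surj (x : asymp) : exists u, x = cls u.
Proof. by exists (repr (x : Quotient.quot null_seq)); rewrite /cls reprK. Qed.

Lemma clsD (u v : bddseq) : cls (u + v) = cls u + cls v.
Proof. exact: Quotient.pi_add. Qed.

Lemma clsN (u : bddseq) : cls (- u) = - cls u.
Proof. exact: Quotient.pi_opp. Qed.

Definition qmul (x y : asymp) : asymp :=
  cls (repr (x : Quotient.quot null_seq) * repr (y : Quotient.quot null_seq)).

Lemma cls_eq_null (u v : bddseq) : cls u = cls v <-> u - v \in null_seq.
Proof.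
rewrite /cls; split => [/eqP|H]; last apply/eqP; rewrite ?Quotient.idealrBE //.
by rewrite -Quotient.idealrBE.
Qed.

Lemma qmulE (u v : bddseq) : qmul (cls u) (cls v) = cls (u * v).
Proof.
apply/cls_eq_null; set u' := repr _; set v' := repr _.
have uu : u' - u \in null_seq by apply/cls_eq_null; rewrite /cls reprK.
have vv : v' - v \in null_seq by apply/cls_eq_null; rewrite /cls reprK.
have -> : u' * v' - u * v = (u' - u) * v' + u * (v' - v).
  by rewrite mulrBl mulrBr subrKA.
by apply: rpredD; [exact: null_seqMr | exact: null_seqMl].
Qed.

Lemma qmulA : associative qmul.
Proof.
move=> x y z; have [u ->] := cls_surj x; have [v ->] := cls_surj y; have [w ->] := cls_surj z.
by rewrite !qmulE mulrA.
Qed.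

Lemma qmul1 : left_id (cls 1) qmul.
Proof. by move=> x; have [u ->] := cls_surj x; rewrite qmulE mul1r. Qed.

Lemma qmulr1 : right_id (cls 1) qmul.
Proof. by move=> x; have [u ->] := cls_surj x; rewrite qmulE mulr1. Qed.

Lemma qmulDl : left_distributive qmul +%R.
Proof.
move=> x y z; have [u ->] := cls_surj x; have [v ->] := cls_surj y; have [w ->] := cls_surj z.
by rewrite -clsD !qmulE mulrDl clsD.
Qed.

Lemma qmulDr : right_distributive qmul +%R.
Proof.
move=> x y z; have [u ->] := cls_surj x; have [v ->] := cls_surj y; have [w ->] := cls_surj z.
by rewrite -clsD !qmulE mulrDr clsD.
Qed.

HB.instance Definition _ := GRing.Zmodule_isPzRing.Build asymp qmulA qmul1 qmulr1 qmulDl qmulDr.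

Lemma cls_is_monoid_morphism : monoid_morphism cls.
Proof. by split=> // u v; rewrite -qmulE. Qed.
Lemma cls_is_zmod_morphism : zmod_morphism cls.
Proof. by move=> u v; rewrite clsD clsN. Qed.
HB.instance Definition _ := GRing.isZmodMorphism.Build bddseq asymp cls cls_is_zmod_morphism.
HB.instance Definition _ := GRing.isMonoidMorphism.Build bddseq asymp cls cls_is_monoid_morphism.

Lemma clsM (u v : bddseq) : cls (u * v) = cls u * cls v.
Proof. exact: rmorphM. Qed.

Lemma bstar_subproof (u : bddseq) : (fun m => star (u m)) \in bounded_seq.
Proof.
have /bounded_seqP[M HM] := bfunP u; apply/bounded_seqP.
by exists M => m; rewrite cnorm_star.
Qed.
Definition bstar (u : bddseq) : bddseq := BSeq (bstar_subproof u).

Definition qstar (x : asymp) : asymp := cls (bstar (repr (x : Quotient.quot null_seq))).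

Lemma qstarE (u : bddseq) : qstar (cls u) = cls (bstar u).
Proof.
apply/cls_eq => e e0; set u' := repr _.
have /cls_eq/(_ e e0) : cls u' = cls u by rewrite /cls reprK.
by under eq_near do rewrite -cnorm_star starB.
Qed.

Lemma bddseq_eq (u v : bddseq) : (forall m, u m = v m) -> u = v.
Proof. by move=> uv; apply: val_inj; apply/funext. Qed.

Lemma qstarD : {morph qstar : x y / x + y}.
Proof.
move=> x y; have [u ->] := cls_surj x; have [v ->] := cls_surj y.
rewrite -clsD !qstarE -clsD; congr cls; apply: bddseq_eq => m; exact: starD.
Qed.

Lemma qstarM x y : qstar (x * y) = qstar y * qstar x.
Proof.
have [u ->] := cls_surj x; have [v ->] := cls_surj y.
rewrite -rmorphM !qstarE -rmorphM; congr cls; apply: bddseq_eq => m; exact: starM.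
Qed.

Lemma qstarK : involutive qstar.
Proof.
move=> x; have [u ->] := cls_surj x.
rewrite !qstarE; congr cls; apply: bddseq_eq => m; exact: starK.
Qed.

Section Automorphism.
Variable alpha : starAut A.

Lemma baut_subproof (u : bddseq) : (fun m => alpha (u m)) \in bounded_seq.
Proof.
have /bounded_seqP[M HM] := bfunP u; apply/bounded_seqP.
by exists M => m; exact: le_trans (aut_contract _ _) (HM m).
Qed.
Definition baut (u : bddseq) : bddseq := BSeq (baut_subproof u).

(** Well defined because automorphisms are contractive. *)
Definition qaut (x : asymp) : asymp := cls (baut (repr (x : Quotient.quot null_seq))).

Lemma qautE (u : bddseq) : qaut (cls u) = cls (baut u).
Proof.
apply/cls_eq => e e0; set u' := repr _.
have /cls_eq/(_ e e0) : cls u' = cls u by rewrite /cls reprK.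
by apply: filterS => m /=; rewrite -rmorphB; exact/le_lt_trans/aut_contract.
Qed.

Lemma qaut_is_zmod_morphism : zmod_morphism qaut.
Proof.
move=> x y; have [u ->] := cls_surj x; have [v ->] := cls_surj y.
rewrite -rmorphB !qautE -rmorphB; congr cls; apply: bddseq_eq => m; exact: rmorphB.
Qed.

Lemma qaut_is_monoid_morphism : monoid_morphism qaut.
Proof.
split=> [|x y].
  rewrite -(rmorph1 cls) qautE; congr cls; apply: bddseq_eq => m; exact: rmorph1.
have [u ->] := cls_surj x; have [v ->] := cls_surj y.
rewrite -rmorphM !qautE -rmorphM; congr cls; apply: bddseq_eq => m; exact: rmorphM.
Qed.

HB.instance Definition _ := GRing.isZmodMorphism.Build asymp asymp qaut qaut_is_zmod_morphism.
HB.instance Definition _ := GRing.isMonoidMorphism.Build asymp asymp qaut qaut_is_monoid_morphism.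

Lemma qaut_star x : qaut (qstar x) = qstar (qaut x).
Proof.
have [u ->] := cls_surj x.
rewrite !(qstarE, qautE); congr cls; apply: bddseq_eq => m; exact: aut_star.
Qed.

End Automorphism.

Lemma const_subproof (a : A) : (fun _ : nat => a) \in bounded_seq.
Proof. by apply/bounded_seqP; exists (cnorm a). Qed.
Definition const_bddseq (a : A) : bddseq := BSeq (const_subproof a).

Lemma unit_ball_subproof (u : nat -> A) : (forall m, cnorm (u m) <= 1) -> u \in bounded_seq.
Proof. by move=> u1; apply/bounded_seqP; exists 1. Qed.

(** A real part of any lift is almost idempotent far out. *)
Lemma lift_projection x : qstar x = x -> x * x = x ->
  exists2 u : bddseq, cls u = x & forall m, projection (u m).
Proof.
have [u ->] := cls_surj x => /esym; rewrite qstarE => /cls_eq sx xx.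
pose a m := (2^-1)%:C *: (u m + star (u m)).
have sa m : selfadjoint (a m) by rewrite /selfadjoint starZr starD starK addrC.
have ua m : u m - a m = (2^-1)%:C *: (u m - star (u m)).
  rewrite -[in LHS](halfMn (u m)) /a -scalerBr; congr (_ *: _).
  by ncring.
have ab : a \in bounded_seq.
  have /bounded_seqP[M HM] := bfunP u; apply/bounded_seqP; exists M => m.
  rewrite norm_half; have := cnormD (u m) (star (u m)).
  by rewrite cnorm_star; have := HM m; lra.
have aE : cls u = cls (BSeq ab).
  apply/cls_eq => e e0; apply: filterS (sx e e0) => m /=.
  rewrite ua norm_half; have := cnorm_ge0 (u m - star (u m)); lra.
have aa : forall e : R, 0 < e -> \forall m \near \oo, cnorm (a m * a m - a m) < e.
  have /cls_eq : cls (BSeq ab * BSeq ab) = cls (BSeq ab) by rewrite rmorphM /= -aE; exact: xx.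
  by [].
have /choice[q Hq] : forall m, exists q, projection q /\
    (4 * cnorm (a m * a m - a m) < 1 -> cnorm (q - a m) <= 2 * cnorm (a m * a m - a m)).
  move=> m; have [lt1|nlt] := pselect (4 * cnorm (a m * a m - a m) < 1).
    by have [q [pq qa _]] := near_projection (sa m) lt1; exists q.
  by exists 0; split=> //; split; [exact: star0 | rewrite mulr0].
have qb : q \in bounded_seq by apply: unit_ball_subproof => m; exact: proj_norm_le1 (Hq m).1.
exists (BSeq qb); last by move=> m; exact: (Hq m).1.
rewrite aE; apply/cls_eq => e e0.
near=> m; have am1 : cnorm (a m * a m - a m) < Num.min (1 / 4) (e / 2).
  by near: m; apply: aa; rewrite lt_min !divr_gt0.
move: am1; rewrite lt_min => /andP[am1 ame].
by rewrite (le_lt_trans ((Hq m).2 _)) //; lra.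
Unshelve. all: by end_near. Qed.

(** v = y d from the polar decomposition of y; the range projection of v is within
    distance less than 1 of e, hence equal to e. *)
Lemma polish_unitary (e y : A) : projection e -> e * y = y -> y * e = y ->
  cnorm (e - star y * y) < 1 / 20 -> cnorm (e - y * star y) < 1 / 20 ->
  exists2 v, corner_unitary e v & cnorm (v - y) <= 4 * cnorm (e - star y * y).
Proof.
move=> pe ey ye n1 n2; have [se ee] := pe.
have yye : star y * y * e = star y * y by rewrite -mulrA ye.
have eyy : e * (star y * y) = star y * y by rewrite mulrA -{1}se -starM ye.
have := @polar _ _ e y pe; rewrite eyy yye => -[|d [sd ed de dd dn]]; first by lra.
set h := cnorm (e - star y * y) in n1 dn *.
have de2 : cnorm (d - e) <= 2 * h.
  by have := cnorm_ge0 (d - e); have h0 : 0 <= h := cnorm_ge0 _; nra.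
have y2 : cnorm y <= 2.
  have := cnorm_le_dist (star y * y) e; rewrite cnormBC -/h cstar_identity.
  by have := proj_norm_le1 pe; have := cnorm_ge0 y; nra.
pose v := y * d.
have vv : star v * v = e by rewrite /v starM sd mulrA -(mulrA d).
have v1 : cnorm v <= 1.
  have := cstar_identity v; rewrite vv; have := proj_norm_le1 pe; have := cnorm_ge0 v; nra.
have vy : cnorm (v - y) <= 4 * h.
  have -> : v - y = y * (d - e) by rewrite mulrBr ye.
  by have := cnormMle y2 de2; lra.
exists v => //; split=> //; first by exists v => //; rewrite /v -!mulrA de mulrA ey.
have ev : e * v = v by rewrite /v mulrA ey.
have ve : star v * e = star v by rewrite -{1}se -starM ev.
have ve' : v * e = v by rewrite /v -mulrA de.
apply/esym/eqP; rewrite -subr_eq0; apply/eqP/proj_small.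
  split; first by rewrite /selfadjoint starB starM starK se.
  rewrite mulrBr !mulrBl ee (mulrA e) ev -(mulrA v _ e) ve.
  by rewrite -(mulrA v) (mulrA _ v) vv (mulrA v) ve' subrr subr0.
have -> : e - v * star v = (e - y * star y) - (v - y) * star v - y * star (v - y).
  by rewrite starB; ncring.
have := cnormB (e - y * star y - (v - y) * star v) (y * star (v - y)).
have := cnormB (e - y * star y) ((v - y) * star v).
have := cnormMle vy (_ : cnorm (star v) <= 1); rewrite cnorm_star => /(_ v1).
have := cnormMle y2 (_ : cnorm (star (v - y)) <= 4 * h); rewrite cnorm_star => /(_ vy).
lra.
Qed.

(** The compression to the corners of any lift is almost unitary far out, and can
    be polished there; the finitely many other terms are replaced by e. *)
Lemma lift_corner_unitary (e : bddseq) x : (forall m, projection (e m)) ->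
  cls e * x = x -> x * cls e = x -> qstar x * x = cls e -> x * qstar x = cls e ->
  exists2 u : bddseq, cls u = x & forall m, corner_unitary (e m) (u m).
Proof.
move=> pe; have [u0 ->] := cls_surj x; pose y : bddseq := e * u0 * e.
move=> eu ue; have yE : cls u0 = cls y by rewrite !rmorphM eu ue.
rewrite yE qstarE -!rmorphM => yy1 yy2.
have ym m : e m * y m = y m /\ y m * e m = y m.
  have [_ ee] := pe m; have -> : y m = e m * u0 m * e m by [].
  by split; [rewrite !mulrA ee | rewrite -mulrA ee].
have /choice[v Hv] : forall m, exists v, corner_unitary (e m) v /\
    (cnorm (e m - star (y m) * y m) < 1 / 20 -> cnorm (e m - y m * star (y m)) < 1 / 20 ->
     cnorm (v - y m) <= 4 * cnorm (e m - star (y m) * y m)).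
  move=> m; have [ey ye] := ym m.
  have [[n1 n2]|no] := pselect (cnorm (e m - star (y m) * y m) < 1 / 20 /\
      cnorm (e m - y m * star (y m)) < 1 / 20).
    by have [v uv vy] := polish_unitary (pe m) ey ye n1 n2; exists v.
  exists (e m); split; last by move=> ? ?; case: no.
  by have [se ee] := pe m; split; [exists 1; rewrite ?mulr1 | rewrite se | rewrite se].
have vb : v \in bounded_seq.
  apply: unit_ball_subproof => m; have [[_ vv _] _] := Hv m.
  have := cstar_identity (v m); rewrite vv; have := proj_norm_le1 (pe m).
  by have := cnorm_ge0 (v m); nra.
exists (BSeq vb); last by move=> m; exact: (Hv m).1.
apply/cls_eq => eps eps0.
move/esym/cls_eq in yy1; move/esym/cls_eq in yy2.
have c20 : 0 < 1 / 20 :> R by rewrite divr_gt0.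
near=> m.
have : cnorm (e m - star (y m) * y m) < Num.min (1 / 20) (eps / 4).
  by near: m; apply: yy1; rewrite lt_min !divr_gt0.
rewrite lt_min => /andP[n1 n1'].
have n2 : cnorm (e m - y m * star (y m)) < 1 / 20 by near: m; exact: (yy2 _ c20).
by rewrite (le_lt_trans ((Hv m).2 n1 n2)) //; lra.
Unshelve. all: by end_near. Qed.

Lemma near_all (T : eqType) (s : seq T) (P : T -> nat -> Prop) :
  (forall x, x \in s -> \forall m \near \oo, P x m) ->
  \forall m \near \oo, forall x, x \in s -> P x m.
Proof.
elim: s => [|x s IH] H; first by near=> m.
have H1 : \forall m \near \oo, forall y, y \in s -> P y m.
  by apply: IH => y ys; apply: H; rewrite inE ys orbT.
have H2 := H x (mem_head _ _).
near=> m => y; rewrite inE => /orP[/eqP -> | ys].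
  by near: m.
by move: y ys; near: m.
Unshelve. all: by end_near. Qed.

Lemma near_fin (T : finType) (P : T -> nat -> Prop) :
  (forall x, \forall m \near \oo, P x m) -> \forall m \near \oo, forall x, P x m.
Proof.
move=> H; have := @near_all _ (enum T) P (fun x _ => H x).
by apply: filterS => m Hm x; apply: Hm; rewrite mem_enum.
Qed.

End SeqAlgebra.

(** * The algebra of the unitary *)

Section StarRing.
Variables (Q : pzRingType) (st : Q -> Q).
Hypotheses (stD : {morph st : x y / x + y}) (stM : forall x y, st (x * y) = st y * st x)
  (stK : involutive st).

Lemma st0 : st 0 = 0.
Proof. by apply: (addrI (st 0)); rewrite -stD !addr0. Qed.

Lemma st1 : st 1 = 1.
Proof. by have := stM (st 1) 1; rewrite mulr1 stK mulr1. Qed.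

Lemma st_sum I (r : seq I) (P : pred I) (F : I -> Q) :
  st (\sum_(i <- r | P i) F i) = \sum_(i <- r | P i) st (F i).
Proof. exact: (big_morph _ stD st0). Qed.

Lemma stX x k : st (x ^+ k) = st x ^+ k.
Proof. by elim: k => [|k IH]; rewrite ?st1 // exprS stM IH -exprSr. Qed.

Lemma shift_sum (V : nmodType) (F : nat -> V) N : F N = F 0%N ->
  \sum_(i < N) F i.+1 = \sum_(i < N) F i.
Proof.
case: N => [|N] FN; first by rewrite !big_ord0.
by rewrite big_ord_recr big_ord_recl /= FN addrC.
Qed.

(** Indices are natural numbers read modulo N, so that a shift of indices needs no
    wrap-around. *)
Definition cyclic_projections N (P : nat -> Q) : Prop :=
  [/\ forall i, st (P i) = P i, forall i, P i * P i = P i,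
      forall i j, (i < N)%N -> (j < N)%N -> i != j -> P i * P j = 0
    & forall i, P (i + N)%N = P i].

Lemma cyclic_diag_mul N q (x y : nat -> Q) : cyclic_projections N q ->
  (forall i j, q i * x j = x j * q i) ->
  (\sum_(i < N) q i * x i) * (\sum_(i < N) q i * y i) = \sum_(i < N) q i * (x i * y i).
Proof.
move=> [_ qq qo _] qx; rewrite mulr_suml; apply: eq_bigr => i _.
rewrite mulr_sumr (bigD1 i) //= big1 ?addr0.
  by rewrite qx mulrA -(mulrA (x i)) qq -qx !mulrA.
by move=> j ji; rewrite qx mulrA -(mulrA (x i)) qo ?mulr0 ?mul0r // eq_sym.
Qed.

Section ShiftUnitary.
Variables (n : nat) (e v : Q) (P : nat -> Q).
Hypotheses (n0 : (0 < n)%N) (ee : e * e = e) (ev : e * v = v) (ve : v * e = v)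
  (svv : st v * v = e) (vsv : v * st v = e) (se : st e = e)
  (cP : cyclic_projections n.+1 P) (eP : forall i, e * P i = P i * e)
  (vP : forall i, v * P i = P i.+1 * v).

Let f := \sum_(i < n.+1) P i.
Let E := e * f.
Let f' := \sum_(i < n) P i.
(** v on P_0, ..., P_(n-1), and the inverse of v^n on P_n, which returns to P_0. *)
Definition shift_unitary : Q := v * f' + st v ^+ n * P n.
Let w := shift_unitary.

Let esv : e * st v = st v. Proof. by rewrite -{1}se -stM ve. Qed.
Let sve : st v * e = st v. Proof. by rewrite -{1}se -stM ev. Qed.
Let svP i : st v * P i.+1 = P i * st v.
Proof. by case: cP => sP _ _ _; rewrite -(sP i.+1) -stM -vP stM sP. Qed.

Let vXP k i : v ^+ k * P i = P (i + k)%N * v ^+ k.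
Proof.
elim: k i => [|k IH] i; first by rewrite addn0 mul1r mulr1.
by rewrite exprSr -mulrA vP mulrA IH addSnnS mulrA.
Qed.

Let svXP k i : st v ^+ k * P (i + k)%N = P i * st v ^+ k.
Proof.
elim: k i => [|k IH] i; first by rewrite addn0 mul1r mulr1.
by rewrite exprS -mulrA -addSnnS IH mulrA svP mulrA.
Qed.

Let evX k : e * v ^+ k = v ^+ k * e.
Proof. by elim: k => [|k IH]; rewrite ?mul1r ?mulr1 // exprS mulrA ev -{1}ve -!mulrA IH. Qed.

Let esvX k : e * st v ^+ k = st v ^+ k * e.
Proof. by rewrite -stX -{1}se -stM -evX stM se. Qed.

Let vXsv k : v ^+ k * st v ^+ k * e = e.
Proof.
elim: k => [|k IH]; first by rewrite !mul1r.
have -> : v ^+ k.+1 * st v ^+ k.+1 * e = v * (v ^+ k * st v ^+ k * e) * st v.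
  by rewrite exprS (exprSr (st v)) -!mulrA esv sve.
by rewrite IH ve vsv.
Qed.

Let e_vX k : (0 < k)%N -> e * v ^+ k = v ^+ k.
Proof. by case: k => // k _; rewrite exprS mulrA ev. Qed.

Let es_svX k : (0 < k)%N -> e * st v ^+ k = st v ^+ k.
Proof. by case: k => // k _; rewrite exprS mulrA esv. Qed.

Let vXsv' k : (0 < k)%N -> v ^+ k * st v ^+ k = e.
Proof. by move=> k0; rewrite -[st v ^+ k](es_svX k0) esvX mulrA vXsv. Qed.

Let svXv k : (0 < k)%N -> st v ^+ k * v ^+ k = e.
Proof.
case: k => // k _; elim: k => [|k IH]; first by rewrite !expr1.
by rewrite exprSr [v ^+ _]exprS -mulrA (mulrA (st v)) svv e_vX.
Qed.

Let f_split : f = f' + P n.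
Proof. by rewrite /f big_ord_recr. Qed.

Let f'_P : f' * P n = 0.
Proof.
case: cP => _ _ Po _; rewrite mulr_suml big1 // => i _.
by rewrite Po // ?ltnS ?(ltnW (ltn_ord i)) // neq_ltn ltn_ord.
Qed.

Let P_f' : P n * f' = 0.
Proof.
case: cP => _ _ Po _; rewrite mulr_sumr big1 // => i _.
by rewrite Po // ?ltnS ?(ltnW (ltn_ord i)) // neq_ltn ltn_ord orbT.
Qed.

Let f'_idem : f' * f' = f'.
Proof.
case: cP => _ PP Po _; rewrite mulr_suml; apply: eq_bigr => i _.
rewrite mulr_sumr (bigD1 i) //= PP big1 ?addr0 // => j ji.
by rewrite Po // ?ltnS ?(ltnW (ltn_ord _)) // eq_sym.
Qed.

Let e_f' : e * f' = f' * e.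
Proof. by rewrite mulr_sumr mulr_suml; apply: eq_bigr => i _. Qed.

Let st_f' : st f' = f'.
Proof. by case: cP => sP _ _ _; rewrite st_sum; apply: eq_bigr => i _. Qed.

Lemma st_shift : st w = f' * st v + P n * v ^+ n.
Proof. by case: cP => sP _ _ _; rewrite stD !stM stX stK st_f' sP. Qed.

Lemma shift_isometry : st w * w = E.
Proof.
case: cP => _ PP _ Pper.
have cross1 : f' * (st v ^+ n.+1 * P n) = 0.
  by rewrite -(Pper n) svXP mulrA f'_P mul0r.
have cross2 : P n * v ^+ n.+1 * f' = 0.
  rewrite -mulrA (_ : v ^+ n.+1 * f' = f' * v ^+ n.+1) ?mulrA ?P_f' ?mul0r //.
  by rewrite mulr_sumr mulr_suml; apply: eq_bigr => i _; rewrite vXP Pper.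
rewrite st_shift mulrDl !mulrDr.
have -> : f' * st v * (v * f') = f' * e * f' by rewrite -svv !mulrA.
have -> : f' * st v * (st v ^+ n * P n) = 0.
  by rewrite -mulrA (mulrA (st v)) -exprS cross1.
have -> : P n * v ^+ n * (v * f') = 0.
  by rewrite mulrA -(mulrA (P n)) -exprSr cross2.
have -> : P n * v ^+ n * (st v ^+ n * P n) = e * P n.
  by rewrite mulrA -(mulrA (P n)) vXsv' // -eP -mulrA PP.
by rewrite addr0 add0r -e_f' -mulrA f'_idem -mulrDr -f_split.
Qed.

Lemma shift_coisometry : w * st w = E.
Proof.
case: cP => _ PP _ Pper; rewrite st_shift mulrDl !mulrDr.
have -> : v * f' * (f' * st v) = \sum_(i < n) e * P i.+1.
  rewrite mulrA -(mulrA v) f'_idem mulr_sumr mulr_suml; apply: eq_bigr => i _.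
  by rewrite vP -mulrA vsv eP.
rewrite (mulrA _ (P n)) -(mulrA v) f'_P mulr0 mul0r addr0.
rewrite (mulrA _ f') -(mulrA _ (P n)) P_f' mulr0 mul0r add0r.
have -> : st v ^+ n * P n * (P n * v ^+ n) = e * P 0%N.
  by rewrite mulrA -(mulrA (st v ^+ n)) PP -[P n]/(P (0 + n)%N) svXP -mulrA svXv // eP.
by rewrite addrC /E mulr_sumr big_ord_recl.
Qed.

Lemma shift_support : w * E = w.
Proof.
case: cP => _ PP _ _.
have we : w * e = w.
  rewrite mulrDl -!mulrA -eP -e_f' !mulrA ve; congr (_ + _ * _).
  by rewrite -esvX es_svX.
by rewrite mulrA we f_split mulrDr !mulrDl -!mulrA f'_idem f'_P P_f' PP !mulr0 addr0 add0r.
Qed.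

Lemma shift_lt i : (i < n)%N -> w * P i = v * P i.
Proof.
case: cP => _ PP Po _ ilt.
rewrite mulrDl -!mulrA (Po n) ?ltnS ?(ltnW ilt) // ?neq_ltn ?ilt ?orbT // mulr0 addr0.
congr (_ * _); rewrite mulr_suml (bigD1 (Ordinal ilt)) //= PP big1 ?addr0 // => j ji.
by rewrite Po // ltnS ltnW // ltn_ord.
Qed.

Lemma shift_last : w * P n = st v ^+ n * P n.
Proof. by case: cP => _ PP _ _; rewrite mulrDl -!mulrA f'_P PP mulr0 add0r. Qed.

(** From P_0, n steps with v are followed by one step with the inverse of v^n. The
    other P_i are reached from P_0 by w^i, which commutes with w^(n+1). *)
Lemma shift_order : w ^+ n.+1 = E.
Proof.
have wX k : (k <= n)%N -> w ^+ k * P 0%N = v ^+ k * P 0%N.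
  elim: k => [|k IH] kn; first by rewrite !mul1r.
  rewrite exprS -mulrA IH ?(ltnW kn) // vXP add0n mulrA shift_lt //.
  by rewrite -[in LHS](add0n k) -mulrA -vXP mulrA -exprS.
have wN : w ^+ n.+1 * P 0%N = e * P 0%N.
  rewrite exprS -mulrA wX // vXP add0n mulrA shift_last -[in LHS](add0n n) svXP.
  by rewrite -mulrA svXv // eP.
have Pe i : P i * e = v ^+ i * P 0%N * st v ^+ i * e.
  by rewrite vXP add0n -!mulrA (mulrA (v ^+ i)) vXsv.
have wP i : (i <= n)%N -> w ^+ n.+1 * (P i * e) = P i * e.
  move=> ilen; rewrite {1}Pe -(wX i ilen) !mulrA -exprD addnC exprD -!mulrA (mulrA (w ^+ n.+1)).
  rewrite wN eP -(mulrA (P _)) (mulrA e) esvX -(mulrA (st v ^+ i)) ee.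
  by rewrite mulrA wX // mulrA -Pe.
have -> : w ^+ n.+1 = w ^+ n.+1 * E by rewrite exprSr -mulrA shift_support.
rewrite /E /f mulr_sumr mulr_sumr; apply: eq_bigr => i _.
by rewrite eP wP // -ltnS.
Qed.

Section Implements.
Variable a : nat -> Q.
Hypotheses (va : forall k, v * a k = a k.+1 * v) (ea : forall k, e * a k = a k * e)
  (Pa : forall i k, P i * a k = a k * P i) (aper : forall k, a (k + n.+1)%N = a k).

(** a k stands for alpha^k(a). The last summand moves the index down by n, which
    modulo n + 1 is up by 1. *)
Lemma shift_implements k : w * a k = a k.+1 * w.
Proof.
have sva j : st v * a j.+1 = a j * st v.
  by rewrite -{1}sve -mulrA ea -vsv !mulrA -(mulrA (st v)) -va mulrA svv ea -mulrA esv.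
have svXa d j : st v ^+ d * a (j + d)%N = a j * st v ^+ d.
  elim: d j => [|d IH] j; first by rewrite addn0 mul1r mulr1.
  by rewrite exprS -mulrA -addSnnS IH mulrA sva mulrA.
rewrite mulrDl mulrDr; congr (_ + _).
  rewrite mulrA -va -!mulrA; congr (_ * _).
  by rewrite mulr_sumr mulr_suml; apply: eq_bigr => i _.
by rewrite -mulrA Pa -(aper k) -addSnnS mulrA svXa mulrA.
Qed.
End Implements.
End ShiftUnitary.

Section RokhlinAverage.
Variables (al : {rmorphism Q -> Q}) (N : nat) (q : nat -> Q) (w0 E : Q) (a : nat -> Q).
Hypotheses (N0 : (0 < N)%N) (al_st : forall x, al (st x) = st (al x))
  (cq : cyclic_projections N q) (alq : forall i, al (q i) = q i.+1)
  (sww : st w0 * w0 = E) (wsw : w0 * st w0 = E) (wN : w0 ^+ N = E) (wE : w0 * E = w0)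
  (alE : al E = E) (al_w0 : iter N al w0 = w0)
  (qw : forall i j, q i * iter j al w0 = iter j al w0 * q i)
  (ala : forall k, al (a k) = a k.+1) (aper : forall k, a (k + N)%N = a k)
  (w0a : forall k, w0 * a k = a k.+1 * w0) (qa : forall i k, q i * a k = a k * q i).

(** alpha carries each summand to the next, which makes the sum alpha-invariant. *)
Definition rokhlin_average : Q := \sum_(i < N) q i * iter i al w0.
Let w := rokhlin_average.
Let e' := \sum_(i < N) q i * E.

Let iter_st j x : iter j al (st x) = st (iter j al x).
Proof. by elim: j => //= j ->. Qed.
Let iterM j x y : iter j al (x * y) = iter j al x * iter j al y.
Proof. by elim: j => //= j ->; rewrite rmorphM. Qed.
Let iterE j : iter j al E = E.
Proof. by elim: j => //= j ->. Qed.
Let qsw i j : q i * iter j al (st w0) = iter j al (st w0) * q i.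
Proof. by case: cq => sq _ _ _; rewrite iter_st -(sq i) -!stM (qw i j). Qed.

Let st_w : st w = \sum_(i < N) q i * iter i al (st w0).
Proof.
case: cq => sq _ _ _; rewrite st_sum; apply: eq_bigr => i _.
by rewrite stM sq qsw iter_st.
Qed.

Lemma average_isometry : st w * w = e'.
Proof.
rewrite st_w cyclic_diag_mul //; apply: eq_bigr => i _.
by rewrite -iterM sww iterE.
Qed.

Lemma average_coisometry : w * st w = e'.
Proof.
rewrite st_w cyclic_diag_mul //; apply: eq_bigr => i _.
by rewrite -iterM wsw iterE.
Qed.

Lemma average_exp k : w ^+ k.+1 = \sum_(i < N) q i * iter i al (w0 ^+ k.+1).
Proof.
elim: k => [|k IH]; first by rewrite expr1.
rewrite exprS IH cyclic_diag_mul //; apply: eq_bigr => i _.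
by rewrite -iterM -exprS.
Qed.

Lemma average_order : w ^+ N = e'.
Proof.
have := average_exp N.-1; rewrite prednK // wN => ->.
by apply: eq_bigr => i _; rewrite iterE.
Qed.

Lemma average_support : w * e' = w.
Proof.
rewrite cyclic_diag_mul //; apply: eq_bigr => i _.
by rewrite -{1}(iterE i) -iterM wE.
Qed.

Lemma average_fixed : al w = w.
Proof.
rewrite rmorph_sum -[RHS](@shift_sum _ (fun i => q i * iter i al w0)); last first.
  by case: cq => _ _ _ qper; rewrite al_w0 -{1}(add0n N) qper.
by apply: eq_bigr => i _; rewrite rmorphM alq.
Qed.

(** On q_i, alpha^i(w0) implements alpha^i alpha alpha^(-i) = alpha; the power
    alpha^(-i) is written as alpha^(i (N - 1)). *)
Lemma average_implements k : w * a k = a k.+1 * w.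
Proof.
have alXa j d : iter j al (a d) = a (d + j)%N.
  by elim: j => [|j IH] /=; rewrite ?addn0 // IH ala addnS.
have aperX d m : a (d + m * N)%N = a d.
  by elim: m => [|m IH]; rewrite ?addn0 // mulSn addnCA addnC aper.
rewrite mulr_sumr mulr_suml; apply: eq_bigr => i _.
have ak : a k = iter i al (a (k + i * N.-1)%N).
  by rewrite alXa -addnA -mulnSr prednK // aperX.
have ak1 : a k.+1 = iter i al (a (k + i * N.-1).+1).
  by rewrite alXa addSn -addnA -mulnSr prednK // -addSn aperX.
by rewrite -mulrA ak -iterM w0a iterM -ak1 mulrA qa -mulrA.
Qed.

End RokhlinAverage.
End StarRing.

(** * Back to the algebra *)

(** The inner statement of tracial approximate representability for fixed F, eps
    and x. *)
Definition representable_up_to (gT : finGroupType) (R : realType) (A : cstarAlgType R)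
    (gamma : autAction gT A) (F : set A) (eps : R) (x : A) : Prop :=
  exists (e : A) (w : gT -> A),
    [/\ projection e, forall g, corner_unitary e (w g) &
    [/\ forall a, F a -> cnorm (e * a - a * e) < eps,
        forall g a, F a ->
          cnorm (gamma g (e * a * e) - w g * (e * a * e) * star (w g)) < eps,
        forall g h, cnorm (w g * w h - w (g * h)%g) < eps
      & [/\ forall g h, cnorm (gamma g (w h) - w h) < eps,
        mvn_into_hereditary (1 - e) x
      & 1 - eps < cnorm (e * x * e)]]].

Section Assembly.
Context {R : realType} {A : cstarAlgType R}.
Variables (alpha : starAut A) (n : nat).
Local Notation N := n.+1.
Hypothesis alpha_n : forall a, aut_pow alpha N a = a.

Let kst (a : A) : @asymp R A := cls (const_bddseq a).

Lemma hereditaryD (x a b : A) : hereditary x a -> hereditary x b -> hereditary x (a + b).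
Proof.
move=> /closure_approx xa /closure_approx xb; apply/closure_approx => e e0.
have e2 : 0 < e / 2 by rewrite divr_gt0.
have [_ [a' _ <-] aa] := xa _ e2; have [_ [b' _ <-] bb] := xb _ e2.
exists (x * (a' + b') * x); first by exists (a' + b').
have -> : a + b - x * (a' + b') * x = (a - x * a' * x) + (b - x * b' * x).
  by rewrite mulrDr mulrDl; ncring.
by apply: (le_lt_trans (cnormD _ _)); lra.
Qed.

Lemma iter_qaut k (u : bddseq) : iter k (qaut alpha) (cls u) = cls (iter k (baut alpha) u).
Proof. by elim: k => //= k ->; rewrite qautE. Qed.

Lemma iter_baut k (u : bddseq) m : iter k (baut alpha) u m = iter k alpha (u m).
Proof. by elim: k => //= k <-. Qed.

(** The elements of the family are the lifts of e and of e * w^g, at an index where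
    finitely many limits are within their tolerances. The sequence r carries
    1 - e under c, and the sequence z of projections, dominated by e in the limit,
    bounds the norm of e x e from below through that of z x^2 z. *)
Lemma transfer (F : set A) (eps : R) (x : A) (e w : @asymp R A) (c : A) (r z : @bddseq R A) :
  finite_set F -> 0 < eps -> selfadjoint x -> cnorm x = 1 ->
  qstar w * w = e -> w * qstar w = e -> w * e = w -> w ^+ N = e -> qaut alpha w = w ->
  (forall a, F a -> e * kst a = kst a * e) -> e * kst x = kst x * e ->
  (forall a k, F a -> w * kst (iter k alpha a) = kst (iter k.+1 alpha a) * w) ->
  selfadjoint c -> hereditary x c -> (forall m, c * r m = r m) ->
  cls (bstar r * r) = 1 - e ->
  (forall m, projection (z m)) ->
  (forall m, 1 - Num.min eps 1 / 2 <= cnorm (z m * (x * x) * z m)) ->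
  e * cls z = cls z ->
  representable_up_to (cyclic_action alpha_n) F eps x.
Proof.
move=> Ff eps0 sx x1 sww wsw we wN alw eF ex wa sc xc cr rr pz zx ez.
have se : qstar e = e by rewrite -sww qstarM qstarK.
have ee : e * e = e by rewrite -{1}sww -mulrA we.
have ew : e * w = w by rewrite -wsw -mulrA sww we.
have ale : qaut alpha e = e by rewrite -sww rmorphM /= qaut_star alw.
have wX k : w ^+ k * e = e * w ^+ k.
  by elim: k => [|k IH]; rewrite ?mulr1 ?mul1r // exprS -mulrA IH !mulrA we ew.
have sX k : qstar (w ^+ k) = qstar w ^+ k by exact: (stX qstarM qstarK).
have swX k : qstar w ^+ k * e * w ^+ k = e.
  elim: k => [|k IH]; first by rewrite mul1r mulr1.
  by rewrite exprSr [w ^+ _]exprS -!mulrA (mulrA e) ew (mulrA (qstar w)) sww mulrA IH.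
have wsX k : w ^+ k * e * qstar w ^+ k = e.
  elim: k => [|k IH]; first by rewrite mul1r mulr1.
  have es : e * qstar w = qstar w by rewrite -{1}se -qstarM we.
  by rewrite exprSr [qstar w ^+ _]exprS -!mulrA (mulrA e) es (mulrA w) wsw mulrA IH.
pose W k := e * w ^+ k.
have sW k : qstar (W k) = qstar w ^+ k * e by rewrite qstarM se sX.
have [eb ebE peb] := lift_projection se ee.
have /choice[u Hu] : forall g : 'I_N, exists u : bddseq,
    cls u = W g /\ forall m, corner_unitary (eb m) (u m).
  move=> g; have [|||| u uE cu] := @lift_corner_unitary _ _ eb (W g) peb.
  - by rewrite ebE mulrA ee.
  - by rewrite ebE -mulrA wX mulrA ee.
  - by rewrite ebE sW /W mulrA -(mulrA _ e e) ee swX.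
  - by rewrite ebE sW /W -wX mulrA wsX ee.
  by exists u.
have uE g : cls (u g) = W g by case: (Hu g).
have iter_rm k (y y' : asymp) : iter k (qaut alpha) (y * y') =
    iter k (qaut alpha) y * iter k (qaut alpha) y'.
  by elim: k => //= k ->; rewrite rmorphM.
have iter_e k : iter k (qaut alpha) e = e by elim: k => //= k ->.
have iter_w k : iter k (qaut alpha) w = w by elim: k => //= k ->.
have iter_W j k : iter k (qaut alpha) (W j) = W j.
  elim: j => [|j IH]; first by rewrite /W mulr1.
  by have -> : W j.+1 = W j * w; [rewrite /W exprSr mulrA | rewrite iter_rm IH iter_w].
have iter_k k a : iter k (qaut alpha) (kst a) = kst (iter k alpha a).
  rewrite /kst iter_qaut; congr cls; apply: bddseq_eq => m; exact: iter_baut.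
have wXa k a : F a -> w ^+ k * kst a = kst (iter k alpha a) * w ^+ k.
  move=> Fa; elim: k => [|k IH]; first by rewrite mul1r mulr1.
  by rewrite exprS -mulrA IH mulrA wa // -mulrA.
have WM (g h : 'I_N) : W g * W h = W (g * h)%g.
  rewrite /W -mulrA (mulrA (w ^+ g)) wX -!mulrA (mulrA e) ee -exprD [(g + h)%N](divn_eq _ N).
  rewrite exprD mulnC exprM wN.
  case: (_ %/ _)%N => [|k]; first by rewrite mul1r.
  have -> : e ^+ k.+1 = e by elim: k => [|k IH] //; rewrite exprS IH ee.
  by rewrite mulrA ee.
have [s Fs] := (finite_seqP F).1 Ff.
have N1 : \forall m \near \oo, forall a, a \in s -> cnorm (eb m * a - a * eb m) < eps.
  apply: near_all => a sa; have Fa : F a by rewrite Fs.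
  have /cls_eq : cls (eb * const_bddseq a) = cls (const_bddseq a * eb).
    by rewrite !clsM ebE; exact: eF.
  exact.
have N2 : \forall m \near \oo, forall ga, ga \in [seq (g, a) | g <- enum 'I_N, a <- s] ->
    cnorm (iter ga.1 alpha (eb m * ga.2 * eb m) -
           u ga.1 m * (eb m * ga.2 * eb m) * star (u ga.1 m)) < eps.
  apply: near_all => -[g a] /allpairsP[[g' a'] /= [_ sa [-> ->]]] {g a}.
  have Fa : F a' by rewrite Fs.
  have /cls_eq/(_ _ eps0) : cls (iter g' (baut alpha) (eb * const_bddseq a' * eb)) =
      cls (u g' * (eb * const_bddseq a' * eb) * bstar (u g')).
    rewrite -iter_qaut !clsM -qstarE uE ebE -/(kst a') !iter_rm iter_e iter_k sW.
    have wae : w ^+ g' * kst a' * (e * qstar w ^+ g') = kst (iter g' alpha a') * e.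
      by rewrite wXa // -mulrA (mulrA (w ^+ g')) wsX.
    have -> : W g' * (e * kst a' * e) * (qstar w ^+ g' * e) =
        e * (w ^+ g' * kst a' * (e * qstar w ^+ g')) * e.
      by rewrite /W -!mulrA (mulrA e (kst a')) eF // -!mulrA (mulrA e e) ee.
    by rewrite wae -!mulrA ee.
  by apply: filterS => m; rewrite iter_baut.
have N3 : \forall m \near \oo, forall gh : 'I_N * 'I_N,
    cnorm (u gh.1 m * u gh.2 m - u (gh.1 * gh.2)%g m) < eps.
  apply: near_fin => -[g h] /=.
  have /cls_eq : cls (u g * u h) = cls (u (g * h)%g) by rewrite clsM !uE WM.
  exact.
have N4 : \forall m \near \oo, forall gh : 'I_N * 'I_N,
    cnorm (iter gh.1 alpha (u gh.2 m) - u gh.2 m) < eps.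
  apply: near_fin => -[g h] /=.
  have /cls_eq/(_ _ eps0) : cls (iter g (baut alpha) (u h)) = cls (u h).
    by rewrite -iter_qaut uE iter_W.
  by apply: filterS => m; rewrite iter_baut.
have N5 : \forall m \near \oo,
    cnorm ((1 - eb m) - (1 - eb m) * (star (r m) * r m) * (1 - eb m)) < 1.
  have /cls_eq/(_ _ ltr01) : cls (1 - eb) = cls ((1 - eb) * (bstar r * r) * (1 - eb)).
    rewrite 2!clsM rr rmorphB rmorph1 /= ebE.
    have E2 : (1 - e) * (1 - e) = 1 - e by rewrite mulrBl mul1r mulrBr mulr1 ee subrr subr0.
    by rewrite !E2.
  by [].
pose e' := Num.min eps 1.
have e'0 : 0 < e' / 4 by rewrite divr_gt0 // lt_min eps0 ltr01.
(* z x^2 z = z (e x e)^2 z in the limit, whose norm is at least 1 - e' / 2 *)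
have N6 : \forall m \near \oo, cnorm (z m * (x * x) * z m -
    z m * ((eb m * x * eb m) * (eb m * x * eb m)) * z m) < e' / 4.
  have /cls_eq/(_ _ e'0) : cls (z * (const_bddseq x * const_bddseq x) * z) =
      cls (z * ((eb * const_bddseq x * eb) * (eb * const_bddseq x * eb)) * z).
    rewrite !clsM ebE -/(kst x).
    have sz : qstar (cls z) = cls z.
      by rewrite qstarE; congr cls; apply: bddseq_eq => m; case: (pz m).
    have ze : cls z * e = cls z by rewrite -{1}sz -se -qstarM ez sz.
    by rewrite -!mulrA ez (mulrA (cls z) e) ze (mulrA e e) ee (mulrA e (kst x)) ex -!mulrA ez.
  by [].
have [m [[M1 M2] [[M3 M4] [M5 M6]]]] :=
  filter_ex (filterI (filterI N1 N2) (filterI (filterI N3 N4) (filterI N5 N6))).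
exists (eb m), (fun g => u g m); split => //.
  by move=> g; case: (Hu g).
split.
- by move=> a Fa; apply: M1; move: Fa; rewrite Fs.
- move=> g a; rewrite Fs => sa; rewrite /cyclic_action /= aut_powE.
  by apply: (M2 (g, a)); apply/allpairsP; exists (g, a); rewrite mem_enum.
- by move=> g h; exact: (M3 (g, h)).
split.
- by move=> g h; rewrite /cyclic_action /= aut_powE; exact: (M4 (g, h)).
- exact: mvn_of_approx (projC (peb m)) xc sc (cr m) M5.
have := zx m; rewrite -/e'; set y := eb m * x * eb m in M6 *.
have := cnorm_le_dist (z m * (x * x) * z m) (z m * (y * y) * z m).
have := cnormMle (cnormMle (proj_norm_le1 (pz m)) (cnormM y y)) (proj_norm_le1 (pz m)).
rewrite mul1r mulr1 ltNge => y2 dist low; apply/negP => yeps.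
have y0 := cnorm_ge0 y.
have e'E : e' = eps by apply/min_idPl; lra.
rewrite e'E in M6 low.
nra.
Qed.

End Assembly.

(** * The two tracial conditions as families *)

Section Families.
Context {R : realType} {A : cstarAlgType R}.

Lemma cnorm_sum (I : Type) (r : seq I) (F : I -> A) :
  cnorm (\sum_(i <- r) F i) <= \sum_(i <- r) cnorm (F i).
Proof.
elim: r => [|i r IH]; first by rewrite !big_nil cnorm0.
by rewrite !big_cons (le_trans (cnormD _ _)) // lerD2l.
Qed.

Lemma orth_sum_projection (T : finType) (p : T -> A) : (forall g, projection (p g)) ->
  (forall g h, g != h -> p g * p h = 0) -> projection (\sum_g p g).
Proof.
move=> pp po; split.
  by rewrite /selfadjoint star_sum; apply: eq_bigr => g _; case: (pp g).
rewrite mulr_suml; apply: eq_bigr => g _.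
rewrite mulr_sumr (bigD1 g) //= big1 ?addr0; first by case: (pp g).
by move=> h hg; rewrite po // eq_sym.
Qed.

Definition rokhlin_approx (gT : finGroupType) (gamma : autAction gT A)
    (F : set A) (eps : R) (p : gT -> A) : Prop :=
  [/\ forall g, projection (p g), forall g h, g != h -> p g * p h = 0,
      forall g h, cnorm (gamma g (p h) - p (g * h)%g) < eps &
      forall g a, F a -> cnorm (p g * a - a * p g) < eps].

(** The tolerance is divided by more than the order of the group, because the sum of the
    projections is what has to commute with F. *)
Lemma rokhlin_family (gT : finGroupType) (gamma : autAction gT A) :
  tracial_Rokhlin gamma ->
  tracial_family (fun p : gT -> A => \sum_g p g) (rokhlin_approx gamma).
Proof.
move=> Rok; split.
  move=> F F' e e' p FF' ee' [pp po pg pa]; split=> // [g h|g a Fa].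
    exact: lt_le_trans (pg g h) ee'.
  exact: lt_le_trans (pa g a (FF' a Fa)) ee'.
move=> F e x Ff e0 px x1; pose e' := e / (#|gT|.+1)%:R.
have e'0 : 0 < e' by rewrite divr_gt0.
have e'e : e' <= e by rewrite ler_pdivrMr // ler_peMr ?(ltW e0) // ler1n.
have [p [pp po [pg pa mvn big]]] := Rok F e' x Ff e'0 px x1.
exists p; split=> //; first exact: orth_sum_projection.
- by split=> // [g h|g a Fa]; [exact: lt_le_trans (pg g h) _ | exact: lt_le_trans (pa g a Fa) _].
- move=> a Fa; rewrite mulr_suml mulr_sumr -sumrB.
  apply: (le_lt_trans (cnorm_sum _ _)).
  apply: (@le_lt_trans _ _ (\sum_(g : gT) e')).
    by apply: ler_sum => g _; exact/ltW/pa.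
  rewrite sumr_const -mulr_natr /e' mulrAC ltr_pdivrMr // ltr_pM2l // ltr_nat.
  by rewrite cardE.
- by apply: le_lt_trans big; rewrite lerD2l lerN2.
Qed.

Definition inner_approx (alpha : starAut A) (F : set A) (eps : R) (ev : A * A) : Prop :=
  [/\ corner_unitary ev.1 ev.2, cnorm (alpha ev.1 - ev.1) < eps &
    forall a, F a ->
      cnorm (ev.2 * (ev.1 * a * ev.1) * star ev.2 - alpha (ev.1 * a * ev.1)) < eps].

Lemma inner_family (alpha : starAut A) : strongly_tracially_approx_inner alpha ->
  tracial_family fst (inner_approx alpha).
Proof.
move=> inn; split.
  move=> F F' e e' d FF' ee' [cu ea va]; split=> // [|a Fa].
    exact: lt_le_trans ea ee'.
  exact: lt_le_trans (va a (FF' a Fa)) ee'.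
move=> F e x Ff e0 px x1; have [p [v [pp cu [pa com va mvn big]]]] := inn F e x Ff e0 px x1.
by exists (p, v).
Qed.

(** One choice for every tolerance 1 / (m + 1), where both the finite set and the
    test may depend on m, that is on earlier choices. *)
Lemma reserve_seq (K : set A) (c : A) (D : Type) (E : D -> A) P (G : nat -> seq A) (z : nat -> A) :
  reserve K c -> tracial_family E P -> (forall m, K (z m)) ->
  exists (d : nat -> D) (t z' : nat -> A), forall m,
    [/\ projection (E (d m)), P [set` G m] (m.+1%:R^-1 : R) (d m),
      forall a, a \in G m -> cnorm (E (d m) * a - a * E (d m)) < m.+1%:R^-1 &
    [/\ star (t m) * t m = 1 - E (d m), c * t m = t m, K (z' m), z m * z' m = z' m &
        cnorm (E (d m) * z' m - z' m) < m.+1%:R^-1]].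
Proof.
move=> res fam Kz.
have /choice[y Hy] : forall m, exists y : D * A * A,
    [/\ projection (E y.1.1), P [set` G m] (m.+1%:R^-1 : R) y.1.1,
      forall a, a \in G m -> cnorm (E y.1.1 * a - a * E y.1.1) < m.+1%:R^-1 &
    [/\ star y.1.2 * y.1.2 = 1 - E y.1.1, c * y.1.2 = y.1.2, K y.2, z m * y.2 = y.2 &
        cnorm (E y.1.1 * y.2 - y.2) < m.+1%:R^-1]].
  move=> m; have [|||d [t [z' H]]] := res _ _ _ fam [set` G m] (m.+1%:R^-1) (z m).
  - exact: finite_seq.
  - by rewrite invr_gt0.
  - exact: Kz.
  by exists (d, t, z').
by exists (fun m => (y m).1.1), (fun m => (y m).1.2), (fun m => (y m).2).
Qed.

Lemma cls_close (u v : @bddseq R A) : (forall m, cnorm (u m - v m) < m.+1%:R^-1) -> cls u = cls v.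
Proof.
move=> uv; apply/cls_eq => e e0.
have /cvgrPdist_lt/(_ e e0)[K _ HK] := @cvg_harmonic R.
exists K => // m /= Km; apply: lt_trans (uv m) _; have := HK m Km.
by rewrite /= sub0r normrN gtr0_norm ?invr_gt0.
Qed.

Lemma bddseq_sum (I : Type) (r : seq I) (F : I -> @bddseq R A) m :
  (\sum_(i <- r) F i : bddseq) m = \sum_(i <- r) F i m.
Proof.
elim: r => [|i r IH]; first by rewrite !big_nil.
by rewrite !big_cons -IH.
Qed.

End Families.

(** * The cyclic action *)

Section Main.
Context {R : realType} {A : cstarAlgType R}.
Variables (alpha : starAut A) (n : nat).
Local Notation N := n.+1.
Hypothesis alpha_n : forall a, aut_pow alpha N a = a.
Hypothesis n0 : (0 < n)%N.

Lemma iter_period k a : iter (k %% N) alpha a = iter k alpha a.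
Proof.
have NX q b : iter (q * N) alpha b = b.
  by elim: q => // q IH; rewrite mulSn iterD IH -aut_powE alpha_n.
by rewrite [in RHS](divn_eq k N) addnC iterD NX.
Qed.

(** Group elements are read off from natural numbers with [inZp], so that the
    generator of the group adds 1 to the index. *)
Lemma rokhlin_seq (G : nat -> seq A) (d : nat -> 'I_N -> A) :
  (forall m, rokhlin_approx (cyclic_action alpha_n) [set` G m] (m.+1%:R^-1 : R) (d m)) ->
  exists P : nat -> @bddseq R A,
    [/\ cyclic_projections qstar N (fun i => cls (P i)),
        forall i, qaut alpha (cls (P i)) = cls (P i.+1),
        forall i (u : bddseq), (forall m, u m \in G m) -> cls (P i) * cls u = cls u * cls (P i),
        forall i m, P i m = d m (inZp i) &
        forall m, (\sum_(i < N) P i : bddseq) m = \sum_g d m g].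
Proof.
move=> Hd; have dp m g : projection (d m g) by case: (Hd m).
have Pb i : (fun m => d m (inZp i)) \in bounded_seq.
  by apply: unit_ball_subproof => m; exact: proj_norm_le1.
exists (fun i => BSeq (Pb i)); split=> //.
- split=> [i|i|i j iN jN ij|i].
  + by rewrite qstarE; congr cls; apply: bddseq_eq => m; case: (dp m (inZp i)).
  + by rewrite -clsM; congr cls; apply: bddseq_eq => m; case: (dp m (inZp i)).
  + rewrite -clsM -[RHS](raddf0 cls); congr cls; apply: bddseq_eq => m.
    case: (Hd m) => _ orth _ _; apply: orth; apply: contra ij => /eqP/(congr1 val) /=.
    by rewrite !modn_small // => ->.
  + by congr cls; apply: bddseq_eq => m /=; congr (d m _); apply: val_inj; rewrite /= modnDr.
- move=> i; rewrite qautE; apply: cls_close => m /=.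
  have [_ _ sh _] := Hd m; have := sh (inZp 1) (inZp i).
  rewrite /cyclic_action /= aut_powE modn_small //=.
  have -> : (inZp 1 * inZp i)%g = inZp i.+1 :> 'I_N; last by [].
  by apply: val_inj; rewrite /= modnDm.
- move=> i u uG; rewrite -!clsM; apply: cls_close => m.
  by have [_ _ _ com] := Hd m; apply: com; exact: uG.
- move=> m; rewrite bddseq_sum; apply: eq_bigr => i _ /=; congr (d m _).
  by apply: val_inj; rewrite /= modn_small.
Qed.

Hypotheses (A_simple : simple A) (alpha_stai : strongly_tracially_approx_inner alpha)
  (alpha_Rokhlin : tracial_Rokhlin (cyclic_action alpha_n)).

Let kst (a : A) : @asymp R A := cls (const_bddseq a).

(** The three families are chosen one after the other at every tolerance, so that the
    finite set of each can contain what the earlier ones produced: e almost commutes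
    with the P_i, and the q_i with w0 and E. The tests z0, z1, z2 are passed on in the
    same order. *)
Lemma cyclic_representable (F : set A) (eps : R) (x : A) :
  finite_set F -> 0 < eps -> positive x -> cnorm x = 1 ->
  representable_up_to (cyclic_action alpha_n) F eps x.
Proof.
move=> Ff eps0 px x1; have [sx _] := px.
have [s Fs] := (finite_seqP F).1 Ff.
(* x joins F, since e' x e' has to be compared with x *)
have [os osP] : exists os : seq A, forall a k, a \in x :: s -> iter k alpha a \in os.
  exists [seq iter k alpha a | a <- x :: s, k <- iota 0 N] => a k sa.
  rewrite -iter_period; apply/allpairsP; exists (a, (k %% N)%N).
  by rewrite mem_iota ltn_mod.
have g01 : (inZp 0 : 'I_N) != inZp 1 by rewrite -val_eqE /= mod0n modn_small.
have s01 : 0 < 1 - Num.min eps 1 / 2 < 1.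
  have : 0 < Num.min eps 1 by rewrite lt_min eps0 ltr01.
  have : Num.min eps 1 <= 1 by rewrite ge_min lexx orbT.
  by move=> ? ?; apply/andP; split; lra.
have [K [z0 [c1 [c2 [c3 [Kz0 Kx [pc1 pc2 pc3] [c12 c13 c23] [res1 res2 res3 [xc1 xc2 xc3]]]]]]]] :=
  reservoir A_simple alpha_Rokhlin g01 px x1 s01.
have famR := rokhlin_family alpha_Rokhlin; have famI := inner_family alpha_stai.
have [d1 [t1 [z1 H1]]] := @reserve_seq _ _ K c1 _ _ _ (fun=> os) (fun=> z0) res1 famR (fun=> Kz0).
have [P [cP alP comP PE sumP]] := @rokhlin_seq (fun=> os) d1 (fun m => let: And4 _ h _ _ := H1 m in h).
pose G2 m := os ++ [seq d1 m g | g <- enum 'I_N].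
have Kz1 m : K (z1 m) by case: (H1 m) => _ _ _ [].
have [d2 [t2 [z2 H2]]] := @reserve_seq _ _ K c2 _ _ _ G2 z1 res2 famI Kz1.
have Kz2 m : K (z2 m) by case: (H2 m) => _ _ _ [].
have pe m : projection (d2 m).1 by case: (H2 m).
have cu m : corner_unitary (d2 m).1 (d2 m).2 by case: (H2 m) => _ [].
have bd_iso (u p : nat -> A) : (forall m, projection (p m)) -> (forall m, star (u m) * u m = p m) ->
    u \in bounded_seq.
  move=> pp up; apply: unit_ball_subproof => m; have := cstar_identity (u m).
  by rewrite up; have := proj_norm_le1 (pp m); have := cnorm_ge0 (u m); nra.
have eb_bd : (fun m => (d2 m).1) \in bounded_seq.
  by apply: unit_ball_subproof => m; exact: proj_norm_le1.
have vb_bd : (fun m => (d2 m).2) \in bounded_seq.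
  by apply: (bd_iso _ (fun m => (d2 m).1)) => // m; case: (cu m).
pose eb := BSeq eb_bd; pose vb := BSeq vb_bd; pose f := \sum_(i < N) P i.
pose w0 := vb * (\sum_(i < n) P i) + bstar vb ^+ n * P n.
(* all translates of w0 are included, as the average involves each of them *)
pose G3 m := os ++ (eb * f) m :: [seq iter k alpha (w0 m) | k <- iota 0 N].
have [d3 [t3 [z3 H3]]] := @reserve_seq _ _ K c3 _ _ _ G3 z2 res3 famR Kz2.
have [q [cq alq comq qE sumq]] := @rokhlin_seq G3 d3 (fun m => let: And4 _ h _ _ := H3 m in h).
have Kz3 m : K (z3 m) by case: (H3 m) => _ _ _ [].
pose e := cls eb; pose v := cls vb.
have ee : e * e = e.
  by rewrite -clsM; congr cls; apply: bddseq_eq => m; case: (pe m).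
have se : qstar e = e.
  by rewrite qstarE; congr cls; apply: bddseq_eq => m; case: (pe m).
have ve1 m : (d2 m).1 * (d2 m).2 = (d2 m).2 /\ (d2 m).2 * (d2 m).1 = (d2 m).2.
  have [[a _ <-] _ _] := cu m; have [_ pp] := pe m.
  by split; rewrite ?mulrA ?pp // -mulrA pp.
have ev : e * v = v.
  by rewrite -clsM; congr cls; apply: bddseq_eq => m; case: (ve1 m).
have ve : v * e = v.
  by rewrite -clsM; congr cls; apply: bddseq_eq => m; case: (ve1 m).
have svv : qstar v * v = e.
  by rewrite qstarE -clsM; congr cls; apply: bddseq_eq => m; case: (cu m).
have vsv : v * qstar v = e.
  by rewrite qstarE -clsM; congr cls; apply: bddseq_eq => m; case: (cu m).
have ale : qaut alpha e = e.
  by rewrite qautE; apply: cls_close => m; case: (H2 m) => _ [].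
have come (u : bddseq) : (forall m, u m \in G2 m) -> e * cls u = cls u * e.
  by move=> uG; rewrite -!clsM; apply: cls_close => m; case: (H2 m) => _ _ com _; apply: (com (u m)); exact: uG.
have vimpl (u : bddseq) : (forall m, u m \in G2 m) -> v * cls u = qaut alpha (cls u) * v.
  move=> uG; have eu := come u uG.
  have conj_v : v * (e * cls u * e) * qstar v = qaut alpha (e * cls u * e).
    rewrite /v /e qstarE -(clsM eb u) -(clsM _ eb) -(clsM vb) -(clsM _ (bstar vb)) qautE.
    apply: cls_close => m.
    by case: (H2 m) => _ [_ _ impl] _ _; apply: impl; exact: uG.
  have alu : e * qaut alpha (cls u) = qaut alpha (cls u) * e.
    by have := congr1 (qaut alpha) eu; rewrite !rmorphM /= ale.
  have eue : e * cls u * e = e * cls u by rewrite eu -mulrA ee.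
  have -> : v * cls u = v * (e * cls u * e) * qstar v * v.
    by rewrite -(mulrA _ (qstar v)) svv -(mulrA v) -(mulrA _ e e) ee eue mulrA ve.
  by rewrite conj_v !rmorphM /= ale alu -!mulrA !ev.
have orbG2 a k : a \in x :: s -> forall m, const_bddseq (iter k alpha a) m \in G2 m.
  by move=> sa m; rewrite mem_cat osP.
have PG2 i m : P i m \in G2 m.
  by rewrite mem_cat PE map_f ?orbT // mem_enum.
have al_kst k a : qaut alpha (kst (iter k alpha a)) = kst (iter k.+1 alpha a).
  by rewrite qautE; congr cls; apply: bddseq_eq.
have iterN k a : kst (iter (k + N) alpha a) = kst (iter k alpha a).
  by rewrite -iter_period modnDr iter_period.
have eP i : e * cls (P i) = cls (P i) * e by apply: come.
have vP i : v * cls (P i) = cls (P i.+1) * v by rewrite -alP; apply: vimpl.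
have Pk i a k : a \in x :: s -> cls (P i) * kst (iter k alpha a) = kst (iter k alpha a) * cls (P i).
  by move=> sa; apply: comP => m; exact: osP.
have ek a k : a \in x :: s -> e * kst (iter k alpha a) = kst (iter k alpha a) * e.
  by move=> sa; apply: come; exact: orbG2.
have vk a k : a \in x :: s -> v * kst (iter k alpha a) = kst (iter k.+1 alpha a) * v.
  by move=> sa; rewrite -al_kst; apply: vimpl; exact: orbG2.
pose w1 := shift_unitary qstar n v (fun i => cls (P i)).
pose F0 := \sum_(i < N) cls (P i).
have w1E : cls w0 = w1.
  by rewrite /w0 /w1 /shift_unitary clsD !clsM rmorph_sum rmorphXn /= qstarE.
have fE : cls f = F0 by rewrite rmorph_sum.
pose E := e * F0.
have sww : qstar w1 * w1 = E := shift_isometry qstarD qstarM qstarK n0 ev ve svv vsv se cP eP vP.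
have wsw : w1 * qstar w1 = E := shift_coisometry qstarD qstarM qstarK n0 ev svv vsv cP eP vP.
have wE : w1 * E = w1 := shift_support qstarM qstarK n0 ev ve se cP eP.
have wN : w1 ^+ N = E := shift_order qstarM qstarK n0 ee ev ve svv vsv se cP eP vP.
have eF0 : e * F0 = F0 * e.
  by rewrite mulr_sumr mulr_suml; apply: eq_bigr => i _; exact: eP.
have sF0 : qstar F0 = F0.
  case: (cP) => sP _ _ _; rewrite (st_sum qstarD); apply: eq_bigr => i _; exact: sP.
have alF0 : qaut alpha F0 = F0.
  rewrite rmorph_sum -[RHS](@shift_sum _ (fun i => cls (P i))).
    by apply: eq_bigr => i _; exact: alP.
  by case: (cP) => _ _ _ per; rewrite -{1}(add0n N) per.
have F0F0 : F0 * F0 = F0.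
  have := cyclic_diag_mul (fun=> 1) cP (fun i j => commr1 _).
  by rewrite mulr1 -mulr_suml mulr1.
have EE : E * E = E by rewrite /E {2}eF0 mulrA -(mulrA e) F0F0 -mulrA -eF0 mulrA ee.
have sE : qstar E = E by rewrite /E qstarM se sF0 eF0.
have alE : qaut alpha E = E by rewrite rmorphM /= ale alF0.
have Ek a : a \in x :: s -> E * kst a = kst a * E.
  move=> sa; have ek0 := ek a 0%N sa; have Pk0 i := Pk i a 0%N sa.
  have F0k : F0 * kst a = kst a * F0.
    by rewrite mulr_sumr mulr_suml; apply: eq_bigr => i _; exact: Pk0.
  by rewrite /E -mulrA F0k !mulrA ek0.
have w1k a : a \in x :: s -> forall k, w1 * kst (iter k alpha a) = kst (iter k.+1 alpha a) * w1.
  move=> sa k.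
  exact: (shift_implements qstarM ev ve svv vsv se (fun k => vk a k sa) (fun k => ek a k sa)
    (fun i k => Pk i a k sa) (fun k => iterN k a)).
have clsE : cls (eb * f) = E by rewrite clsM fE.
have qE' i : cls (q i) * E = E * cls (q i).
  by rewrite -clsE; apply: comq => m; rewrite mem_cat mem_head orbT.
have qk i a k : a \in x :: s -> cls (q i) * kst (iter k alpha a) = kst (iter k alpha a) * cls (q i).
  by move=> sa; apply: comq => m; rewrite mem_cat osP.
have qw i j : cls (q i) * iter j (qaut alpha) w1 = iter j (qaut alpha) w1 * cls (q i).
  rewrite -w1E iter_qaut; apply: comq => m; rewrite iter_baut -iter_period.
  rewrite mem_cat in_cons; apply/or3P/Or33/mapP; exists (j %% N)%N => //.
  by rewrite mem_iota ltn_mod.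
have alw1 : iter N (qaut alpha) w1 = w1.
  rewrite -w1E iter_qaut; congr cls; apply: bddseq_eq => m.
  by rewrite iter_baut -iter_period modnn.
pose al : {rmorphism asymp -> asymp} := qaut alpha.
pose w := rokhlin_average al N (fun i => cls (q i)) w1.
pose e' := \sum_(i < N) cls (q i) * E.
have sww' : qstar w * w = e' :=
  average_isometry qstarD qstarM (@qaut_star _ _ alpha : forall x, al _ = _) cq sww alE qw.
have wsw' : w * qstar w = e' :=
  average_coisometry qstarD qstarM (@qaut_star _ _ alpha : forall x, al _ = _) cq wsw alE qw.
have wE' : w * e' = w := average_support cq wE alE qw.
have wN' : w ^+ N = e' := average_order (al := al) (ltn0Sn n) cq wN alE qw.
have alw : qaut alpha w = w := average_fixed (al := al) cq alq alw1.
have wk a k : a \in x :: s -> w * kst (iter k alpha a) = kst (iter k.+1 alpha a) * w.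
  move=> sa.
  exact: (average_implements (al := al) (ltn0Sn n) (fun j => al_kst j a)
    (fun j => iterN j a) (w1k a sa) (fun i j => qk i a j sa)).
pose q0 := \sum_(i < N) cls (q i).
have e'E : e' = q0 * E by rewrite mulr_suml.
have q0E : q0 * E = E * q0 by rewrite mulr_sumr mulr_suml; apply: eq_bigr => i _; exact: qE'.
have e'k a : a \in x :: s -> e' * kst a = kst a * e'.
  move=> sa; have q0k : q0 * kst a = kst a * q0.
    by rewrite mulr_sumr mulr_suml; apply: eq_bigr => i _; exact: (qk i a 0%N).
  by rewrite e'E -(mulrA q0) Ek // (mulrA q0) q0k -(mulrA _ q0).
(* with f the sum of the P_i, 1 - q E = (1 - f) + f (1 - e) f + E (1 - q) E, and the
   three terms are carried under c1, c2 and c3 *)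
have F0m m : (\sum_(i < N) P i : bddseq) m = \sum_g d1 m g by exact: sumP.
have t1_bd : t1 \in bounded_seq.
  apply: (bd_iso _ (fun m => 1 - \sum_g d1 m g)) => m.
    by apply: projC; case: (H1 m).
  by case: (H1 m) => _ _ _ [].
have t2_bd : t2 \in bounded_seq.
  apply: (bd_iso _ (fun m => 1 - (d2 m).1)) => m; first exact: projC.
  by case: (H2 m) => _ _ _ [].
have t3_bd : t3 \in bounded_seq.
  apply: (bd_iso _ (fun m => 1 - \sum_g d3 m g)) => m.
    by apply: projC; case: (H3 m).
  by case: (H3 m) => _ _ _ [].
pose T1 := BSeq t1_bd; pose T2 := BSeq t2_bd; pose T3 := BSeq t3_bd.
pose r := T1 + T2 * f + T3 * (eb * f).
have ct1 m : c1 * t1 m = t1 m by case: (H1 m) => _ _ _ [].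
have ct2 m : c2 * t2 m = t2 m by case: (H2 m) => _ _ _ [].
have ct3 m : c3 * t3 m = t3 m by case: (H3 m) => _ _ _ [].
have star_orth (a b : A) : projection a -> projection b -> a * b = 0 -> b * a = 0.
  by move=> [sa _] [sb _] ab; rewrite -sa -sb -starM ab star0.
have c21 := star_orth _ _ pc1 pc2 c12; have c31 := star_orth _ _ pc1 pc3 c13.
have c32 := star_orth _ _ pc2 pc3 c23.
have tt (c c' : A) (t t' : bddseq) : projection c -> c * c' = 0 -> (forall m, c * t m = t m) ->
    (forall m, c' * t' m = t' m) -> qstar (cls t) * cls t' = 0.
  move=> [scc _] cc' ct ct'; rewrite qstarE -clsM -[RHS](raddf0 cls); congr cls.
  apply: bddseq_eq => m; rewrite -[LHS]/(star (t m) * t' m) -ct -ct' starM scc.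
  by rewrite -mulrA (mulrA c) cc' mul0r mulr0.
apply: (@transfer _ _ alpha n alpha_n F eps x e' w (c1 + c2 + c3) r (BSeq (unit_ball_subproof
  (fun m => proj_norm_le1 (Kx _ (Kz3 m)).1)))) => //.
- by move=> a; rewrite Fs => sa; apply: e'k; rewrite inE orbC; apply/orP; left.
- by apply: e'k; rewrite inE eqxx.
- by move=> a k; rewrite Fs => sa; apply: wk; rewrite inE orbC; apply/orP; left.
- by case: pc1 pc2 pc3 => s1 _ [s2 _] [s3 _]; rewrite /selfadjoint !starD s1 s2 s3.
- by apply: hereditaryD => //; exact: hereditaryD.
- move=> m; rewrite -[r m]/(t1 m + t2 m * f m + t3 m * (eb * f) m).
  have [[_ cc1] [_ cc2] [_ cc3]] := And3 pc1 pc2 pc3.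
  have -> : (c1 + c2 + c3) * (t1 m + t2 m * f m + t3 m * (eb * f) m) =
      (c1 + c2 + c3) * t1 m + (c1 + c2 + c3) * t2 m * f m + (c1 + c2 + c3) * t3 m * (eb * f) m.
    by ncring.
  rewrite -[in LHS](ct1 m) -[in LHS](ct2 m) -[in LHS](ct3 m) !mulrA !mulrDl.
  by rewrite cc1 cc2 cc3 c12 c13 c23 c21 c31 c32 !(mul0r, add0r, addr0) ct1 ct2 ct3.
- rewrite clsM -qstarE; pose a1 := qstar (cls T1); pose a2 := qstar (cls T2); pose a3 := qstar (cls T3).
  have t11 : a1 * cls T1 = 1 - F0.
    rewrite /a1 qstarE -(clsM (bstar T1)) -fE -(rmorph1 cls) -rmorphB; congr cls.
    apply: bddseq_eq => m; rewrite -[RHS]/(1 - f m) F0m.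
    by case: (H1 m) => _ _ _ [].
  have t22 : a2 * cls T2 = 1 - e.
    rewrite /a2 qstarE -(clsM (bstar T2)) -(rmorph1 cls) -rmorphB; congr cls.
    by apply: bddseq_eq => m; case: (H2 m) => _ _ _ [].
  have t33 : a3 * cls T3 = 1 - q0.
    have -> : q0 = cls (\sum_(i < N) q i) by rewrite rmorph_sum.
    rewrite /a3 qstarE -(clsM (bstar T3)) -(rmorph1 cls) -rmorphB; congr cls.
    apply: bddseq_eq => m; rewrite -[RHS]/(1 - (\sum_(i < N) q i : bddseq) m) sumq.
    by case: (H3 m) => _ _ _ [].
  have -> : cls r = cls T1 + cls T2 * F0 + cls T3 * E by rewrite !clsD !clsM fE.
  rewrite qstarD (qstarD (cls T1)) (qstarM _ F0) (qstarM _ E) sF0 sE -/a1 -/a2 -/a3.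
  have -> : (a1 + F0 * a2 + E * a3) * (cls T1 + cls T2 * F0 + cls T3 * E) =
      a1 * cls T1 + F0 * (a2 * cls T2) * F0 + E * (a3 * cls T3) * E +
      ((a1 * cls T2) * F0 + (a1 * cls T3) * E + F0 * (a2 * cls T1) +
       F0 * (a2 * cls T3) * E + E * (a3 * cls T1) + E * (a3 * cls T2) * F0) by ncring.
  rewrite t11 t22 t33 (tt c1 c2) // (tt c1 c3) // (tt c2 c1) // (tt c2 c3) // (tt c3 c1) // (tt c3 c2) //.
  rewrite !(mul0r, mulr0, addr0).
  have -> : F0 * (1 - e) * F0 = F0 - E.
    by rewrite mulrBr mulrBl mulr1 F0F0 -eF0 -mulrA F0F0.
  have -> : E * (1 - q0) * E = E - e'.
    by rewrite mulrBr mulrBl mulr1 EE -q0E -mulrA EE e'E.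
  by ncring.
- by move=> m; case: (Kx _ (Kz3 m)).
- by move=> m; case: (Kx _ (Kz3 m)).
pose Z1 := BSeq (unit_ball_subproof (fun m => proj_norm_le1 (Kx _ (Kz1 m)).1)).
pose Z2 := BSeq (unit_ball_subproof (fun m => proj_norm_le1 (Kx _ (Kz2 m)).1)).
set Z3 := BSeq _.
have F0Z : F0 * cls Z1 = cls Z1.
  rewrite -fE -clsM; apply: cls_close => m; rewrite -[(f * Z1) m]/(f m * z1 m) F0m.
  by case: (H1 m) => _ _ _ [].
have eZ : e * cls Z2 = cls Z2.
  by rewrite -(clsM eb); apply: cls_close => m; case: (H2 m) => _ _ _ [].
have qZ : q0 * cls Z3 = cls Z3.
  have -> : q0 = cls (\sum_(i < N) q i) by rewrite rmorph_sum.
  rewrite -clsM; apply: cls_close => m.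
  rewrite -[((\sum_(i < N) q i) * Z3) m]/((\sum_(i < N) q i : bddseq) m * z3 m) sumq.
  by case: (H3 m) => _ _ _ [].
have Z12 : cls Z1 * cls Z2 = cls Z2.
  by rewrite -clsM; congr cls; apply: bddseq_eq => m; case: (H2 m) => _ _ _ [].
have Z23 : cls Z2 * cls Z3 = cls Z3.
  by rewrite -clsM; congr cls; apply: bddseq_eq => m; case: (H3 m) => _ _ _ [].
rewrite e'E q0E -mulrA qZ -Z23 mulrA; congr (_ * _).
by rewrite /E -mulrA -Z12 (mulrA F0) F0Z Z12 eZ.
Qed.
End Main.

Lemma trivial_action_representable (R : realType) (A : cstarAlgType R) (alpha : starAut A)
    (alpha_1 : forall a : A, aut_pow alpha 1 a = a) :
  tracially_approx_representable (cyclic_action alpha_1).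
Proof.
split; first by apply/centsP => g _ h _; exact: Zp_mulgC.
move=> F eps x Ff eps0 px x1; exists 1, (fun=> 1).
have p1 : projection (1 : A) by split; [exact: star1 | rewrite mulr1].
have act1 (g : 'I_1) a : cyclic_action alpha_1 g a = a by rewrite ord1.
split=> // [g|]; first by split; [exists 1; rewrite ?mulr1 | rewrite star1 mulr1 | rewrite star1 mulr1].
split=> [a _|g a _|g h|]; rewrite ?act1 ?star1 ?mulr1 ?mul1r ?subrr ?cnorm0 //.
split=> [g h||].
- by rewrite act1 subrr cnorm0.
- exists 0; split; first by split; [exact: star0 | rewrite mulr0].
    by apply/closure_approx => e e0; exists 0; [exists 0; rewrite ?mulr0 ?mul0r | rewrite subrr cnorm0].
  by exists 0; rewrite star0 mulr0.
- by rewrite x1; lra.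
Qed.

Theorem theorem4p6 (R : realType) (A : cstarAlgType R)
    (A_infdim : infinite_dimensional A) (A_simple : simple A)
    (A_sep : separable A)
    (alpha : starAut A) (alpha_stai : strongly_tracially_approx_inner alpha)
    (n : nat) (alpha_n : forall a : A, aut_pow alpha n.+1 a = a)
    (alpha_Rokhlin : tracial_Rokhlin (cyclic_action alpha_n)) :
  tracially_approx_representable (cyclic_action alpha_n).
Proof.
case: n alpha_n alpha_Rokhlin => [|n] alpha_n alpha_Rokhlin.
  exact: trivial_action_representable.
split; first by apply/centsP => g _ h _; exact: Zp_mulgC.
by move=> F eps x Ff eps0 px x1; exact: cyclic_representable.
Qed.
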